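(* Let $\mathcal N=(\hat{\mathcal K},\hat{\mathcal B})$ be a model of $T^R$, $A\subseteq\hat{\mathcal K}$ and $\mathbf b\in\hat{\mathcal K}$. Then $\mathbf b$ is definable over $A$ in $\mathcal N$ if and only if there exist pairwise disjoint events $\{\mathsf E_n:n\in\mathbb N\}\subseteq\hat{\mathcal B}$ such that: - $\sum_{n\in\mathbb N}\mu(\mathsf E_n)=1$; - for each $n$, $\mathsf E_n$ is definable over $A$; - for each $n$, $\mathbf b$ is first-order definable on $\mathsf E_n$ over $A$.
   Context: $L$ is a finite or countable first-order signature and $T$ is a complete first-order $L$-theory all of whose models have at least two elements. The randomization signature $L^R$ is the two-sorted continuous signature with a sort $\mathbb K$ (random elements) and a sort $\mathbb B$ (events). It has: function symbols $[\![\varphi(\cdot)]\!]:\mathbb K^n\to\mathbb B$ for each first-order $L$-formula $\varphi$ with $n$ free variables; a $[0,1]$-valued predicate $\mu$ on $\mathbb B$; the Boolean operations $\top,\bot,\sqcap,\sqcup,\neg$ on $\mathbb B$; and distances $d_{\mathbb B}$ and $d_{\mathbb K}$. A nice randomization of $\mathcal M\models T$ is a pre-structure $(\mathcal K,\mathcal B)$ with an atomless probability space $(\Omega,\mathcal B,\mu)$ satisfying the following. (i) $\mathcal B$ is a $\sigma$-algebra with the Boolean operations interpreted set-theoretically. (ii) $\mathcal K\subseteq M^\Omega$. (iii) $[\![\psi(\vec a)]\!]=\{\omega:\mathcal M\models\psi(\vec a(\omega))\}\in\mathcal B$. (iv) $\mathcal B$ consists exactly of such events. (v) For every $\theta(u,\vec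 v)$ and $\vec b$, some $a\in\mathcal K$ has $[\![\theta(a,\vec b)]\!]=[\![\exists u\,\theta(u,\vec b)]\!]$. (vi) $d_{\mathbb K}(a,b)=\mu[\![a\ne b]\!]$. (vii) $d_{\mathbb B}(\mathsf B,\mathsf C)=\mu(\mathsf B\triangle \mathsf C)$. In addition, its reduction (identifying points at distance $0$) is already complete. $T^R$ is the set of continuous $L^R$-sentences true in all nice randomizations of models of $T$. A model of $T^R$ is $\mathcal N=(\hat{\mathcal K},\hat{\mathcal B})$, with sort-$\mathbb K$ part $\hat{\mathcal K}$ and sort-$\mathbb B$ part $\hat{\mathcal B}$. An element $b$ (of either sort) is definable over $A$ in $\mathcal N$ if there are continuous formulas $\Phi_k(x,\vec a_k)$, with $\vec a_k$ tuples from $A$, whose values converge uniformly in $x$ to the distance $d(x,b)$ of the relevant sort. A first-order formula $\varphi(u,\vec v)$ is functional if $T\models(\forall\vec v)(\exists^{\le1}u)\varphi(u,\vec v)$. For an event $\mathsf E\in\hat{\mathcal B}$, $\mathbf b$ is first-order definable on $\mathsf E$ over $A$ if there are a functional formula $\varphi(u,\vec v)$ and a tuple $\vec{\mathbf a}$ from $A$ with $\mathsf E=[\![\varphi(\mathbf b,\vec{\mathbf a})]\!]$. *)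

(* Defs.v *)
From HB Require Import structures.
From mathcomp Require Import all_boot all_order all_algebra.
From mathcomp Require Import all_classical all_reals all_analysis.
Set Implicit Arguments.
Unset Strict Implicit.
Unset Printing Implicit Defensive.
Import Order.TTheory GRing.Theory Num.Theory.
Import numFieldNormedType.Exports.
Local Open Scope classical_set_scope.
Local Open Scope ring_scope.

(* [countType] allows finite and countably infinite sets of symbols;
   constants are function symbols of arity 0. *)
Record signature := Signature {
  fsym : countType;
  farity : fsym -> nat;
  rsym : countType;
  rarity : rsym -> nat }.

(* Formulas are well scoped: the free variables of a [formula L n] are among
   the n variables indexed by ['I_n].  A quantifier binds variable [ord0], and
   variable i of the context becomes [lift ord0 i] in the body. *)
Inductive term (L : signature) (n : nat) : Type :=
| Var (i : 'I_n)
| App (f : fsym L) (ts : 'I_(farity f) -> term L n).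

Inductive formula (L : signature) : nat -> Type :=
| Eq n (t1 t2 : term L n) : formula L n
| Rel n (r : rsym L) (ts : 'I_(rarity r) -> term L n) : formula L n
| Neg n (phi : formula L n) : formula L n
| And n (phi psi : formula L n) : formula L n
| Or n (phi psi : formula L n) : formula L n
| Ex n (phi : formula L n.+1) : formula L n
| All n (phi : formula L n.+1) : formula L n.

Arguments Var {L n} i.

Record structure (L : signature) := Structure {
  carrier :> Type;
  carrier_inhabited : inhabited carrier;
  finterp : forall f : fsym L, ('I_(farity f) -> carrier) -> carrier;
  rinterp : forall r : rsym L, ('I_(rarity r) -> carrier) -> Prop }.

(* The assignment (x, e 0, e 1, ...). *)
Definition scons (X : Type) (n : nat) (x : X) (e : 'I_n -> X) : 'I_n.+1 -> X :=
  fun i => if unlift ord0 i is Some j then e j else x.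

Fixpoint teval (L : signature) (M : structure L) (n : nat) (e : 'I_n -> M)
    (t : term L n) : M :=
  match t with
  | Var i => e i
  | App f ts => finterp (fun i => teval e (ts i))
  end.

Fixpoint sat (L : signature) (M : structure L) (n : nat) (phi : formula L n) :
    ('I_n -> M) -> Prop :=
  match phi in formula _ n return ('I_n -> M) -> Prop with
  | Eq _ t1 t2 => fun e => teval e t1 = teval e t2
  | Rel _ r ts => fun e => rinterp (fun i => teval e (ts i))
  | Neg _ phi => fun e => ~ sat phi e
  | And _ phi psi => fun e => sat phi e /\ sat psi e
  | Or _ phi psi => fun e => sat phi e \/ sat psi e
  | Ex _ phi => fun e => exists x : M, sat phi (scons x e)
  | All _ phi => fun e => forall x : M, sat phi (scons x e)
  end.

Definition sentence (L : signature) := formula L 0.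
Definition theory (L : signature) := set (sentence L).

Definition holds (L : signature) (M : structure L) (s : sentence L) : Prop :=
  forall e : 'I_0 -> M, sat s e.

Definition models (L : signature) (M : structure L) (T : theory L) : Prop :=
  forall s, T s -> holds M s.

Definition entails (L : signature) (T : theory L) (s : sentence L) : Prop :=
  forall M : structure L, models M T -> holds M s.

Definition complete_theory (L : signature) (T : theory L) : Prop :=
  (exists M : structure L, models M T) /\
  (forall s : sentence L, entails T s \/ entails T (Neg s)).

(* T |= (forall v) (exists^{<=1} u) phi(u, v), where u is variable [ord0]. *)
Definition functional (L : signature) (T : theory L) (n : nat)
    (phi : formula L n.+1) : Prop :=
  forall M : structure L, models M T ->
  forall (v : 'I_n -> M) (u u' : M),
    sat phi (scons u v) -> sat phi (scons u' v) -> u = u'.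

(* Connectives are the continuous functions [0,1]^n -> [0,1]; values outside
   the cube are irrelevant. *)
Definition cube (R : realType) (n : nat) : set 'rV[R]_n :=
  [set v | forall i, 0 <= v 0 i <= 1].

Record connective (R : realType) (n : nat) := Connective {
  conn_fun :> 'rV[R]_n -> R;
  conn_range : forall v, cube v -> 0 <= conn_fun v <= 1;
  conn_continuous : {within @cube R n, continuous conn_fun} }.

(* Terms of sort B with k free variables of sort K and b free variables of
   sort B.  The only terms of sort K are the variables. *)
Inductive eterm (L : signature) (k b : nat) : Type :=
| EVar (j : 'I_b)
| EEvent n (phi : formula L n) (x : 'I_n -> 'I_k)
| ETop
| EBot
| EMeet (t1 t2 : eterm L k b)
| EJoin (t1 t2 : eterm L k b)
| ECompl (t : eterm L k b).

Inductive cformula (R : realType) (L : signature) : nat -> nat -> Type :=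
| CMu k b (t : eterm L k b) : cformula R L k b
| CDistB k b (t1 t2 : eterm L k b) : cformula R L k b
| CDistK k b (x y : 'I_k) : cformula R L k b
| CConn k b n (u : connective R n) (Phi : 'I_n -> cformula R L k b) :
    cformula R L k b
| CSupK k b (Phi : cformula R L k.+1 b) : cformula R L k b
| CInfK k b (Phi : cformula R L k.+1 b) : cformula R L k b
| CSupB k b (Phi : cformula R L k b.+1) : cformula R L k b
| CInfB k b (Phi : cformula R L k b.+1) : cformula R L k b.

Definition csentence (R : realType) (L : signature) := cformula R L 0 0.

Record interpretation (R : realType) (L : signature) := Interpretation {
  sortK : Type;
  sortB : Type;
  event : forall n, formula L n -> ('I_n -> sortK) -> sortB;
  mu : sortB -> R;
  etop : sortB;
  ebot : sortB;
  emeet : sortB -> sortB -> sortB;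
  ejoin : sortB -> sortB -> sortB;
  ecompl : sortB -> sortB;
  distK : sortK -> sortK -> R;
  distB : sortB -> sortB -> R }.

Arguments etop {R L} i.
Arguments ebot {R L} i.

Fixpoint eeval (R : realType) (L : signature) (N : interpretation R L)
    (k b : nat) (eK : 'I_k -> sortK N) (eB : 'I_b -> sortB N)
    (t : eterm L k b) : sortB N :=
  match t with
  | EVar j => eB j
  | EEvent _ phi x => event phi (fun i => eK (x i))
  | ETop => etop N
  | EBot => ebot N
  | EMeet t1 t2 => emeet (eeval eK eB t1) (eeval eK eB t2)
  | EJoin t1 t2 => ejoin (eeval eK eB t1) (eeval eK eB t2)
  | ECompl t => ecompl (eeval eK eB t)
  end.

Fixpoint value (R : realType) (L : signature) (N : interpretation R L)
    (k b : nat) (Phi : cformula R L k b) :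
    ('I_k -> sortK N) -> ('I_b -> sortB N) -> R :=
  match Phi in cformula _ _ k b
      return ('I_k -> sortK N) -> ('I_b -> sortB N) -> R with
  | CMu _ _ t => fun eK eB => mu (eeval eK eB t)
  | CDistB _ _ t1 t2 => fun eK eB => distB (eeval eK eB t1) (eeval eK eB t2)
  | CDistK _ _ x y => fun eK _ => distK (eK x) (eK y)
  | CConn _ _ _ u Phi => fun eK eB => u (\row_i value (Phi i) eK eB)
  | CSupK _ _ Phi => fun eK eB =>
      sup (range (fun x : sortK N => value Phi (scons x eK) eB))
  | CInfK _ _ Phi => fun eK eB =>
      inf (range (fun x : sortK N => value Phi (scons x eK) eB))
  | CSupB _ _ Phi => fun eK eB =>
      sup (range (fun x : sortB N => value Phi eK (scons x eB)))
  | CInfB _ _ Phi => fun eK eB =>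
      inf (range (fun x : sortB N => value Phi eK (scons x eB)))
  end.

(* In continuous logic a sentence is true when its value is 0. *)
Definition ctrue (R : realType) (L : signature) (N : interpretation R L)
    (s : csentence R L) : Prop :=
  forall (eK : 'I_0 -> sortK N) (eB : 'I_0 -> sortB N), value s eK eB = 0.

Definition pseudometric (R : realType) (X : Type) (d : X -> X -> R) : Prop :=
  [/\ forall x, d x x = 0,
      forall x y, d x y = d y x,
      forall x y z, d x z <= d x y + d y z
    & forall x y, 0 <= d x y <= 1].

Definition separated (R : realType) (X : Type) (d : X -> X -> R) : Prop :=
  forall x y, d x y = 0 -> x = y.

(* For a pseudometric, this says that the quotient metric is complete. *)
Definition complete_dist (R : realType) (X : Type) (d : X -> X -> R) : Prop :=
  forall u : nat -> X,
    (forall eps : R, 0 < eps ->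
       exists n0, forall m n, (n0 <= m)%N -> (n0 <= n)%N -> d (u m) (u n) < eps) ->
    exists l : X, forall eps : R, 0 < eps ->
      exists n0, forall n, (n0 <= n)%N -> d (u n) l < eps.

(* A continuous signature prescribes a modulus of uniform continuity for each
   symbol.  Those prescribed here say that every symbol is 1-Lipschitz for the
   sum of the distances of its arguments, which holds in every nice
   randomization. *)
Record pre_structure (R : realType) (L : signature) (N : interpretation R L) :
    Prop := PreStructure {
  pre_inhabited : inhabited (sortK N);
  pre_distK : pseudometric (@distK R L N);
  pre_distB : pseudometric (@distB R L N);
  pre_mu : forall E : sortB N, 0 <= mu E <= 1;
  pre_mu_cont : forall E F : sortB N, `|mu E - mu F| <= distB E F;
  pre_event_cont : forall n (phi : formula L n) (x y : 'I_n -> sortK N),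
    distB (event phi x) (event phi y) <= \sum_(i < n) distK (x i) (y i);
  pre_meet_cont : forall E E' F F' : sortB N,
    distB (emeet E F) (emeet E' F') <= distB E E' + distB F F';
  pre_join_cont : forall E E' F F' : sortB N,
    distB (ejoin E F) (ejoin E' F') <= distB E E' + distB F F';
  pre_compl_cont : forall E F : sortB N,
    distB (ecompl E) (ecompl F) <= distB E F }.

Record metric_structure (R : realType) (L : signature)
    (N : interpretation R L) : Prop := MetricStructure {
  ms_pre : pre_structure N;
  ms_sepK : separated (@distK R L N);
  ms_sepB : separated (@distB R L N);
  ms_completeK : complete_dist (@distK R L N);
  ms_completeB : complete_dist (@distB R L N) }.

Definition atomless (d : measure_display) (Omega : measurableType d)
    (R : realType) (P : probability Omega R) : Prop :=
  forall E : set Omega, measurable E -> (0 < P E)%E ->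
    exists F : set Omega,
      [/\ measurable F, F `<=` E, (0 < P F)%E & (P F < P E)%E].

Section RandomizationData.
Variables (R : realType) (L : signature) (M : structure L).

Definition truth_set (Omega : Type) n (psi : formula L n)
    (a : 'I_n -> Omega -> M) : set Omega :=
  [set w | sat psi (fun i => a i w)].

(* The sort B of the randomization is the sigma-algebra [measurable]. *)
Record randomization := Randomization {
  rnd_display : measure_display;
  rnd_Omega : measurableType rnd_display;
  rnd_prob : probability rnd_Omega R;
  rnd_atomless : atomless rnd_prob;
  rnd_K : set (rnd_Omega -> M);
  rnd_measurable : forall n (psi : formula L n) (a : 'I_n -> rnd_Omega -> M),
    (forall i, rnd_K (a i)) -> measurable (truth_set psi a);
  rnd_exhaustive : forall E : set rnd_Omega, measurable E ->
    exists (n : nat) (psi : formula L n) (a : 'I_n -> rnd_Omega -> M),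
      (forall i, rnd_K (a i)) /\ E = truth_set psi a;
  rnd_witness : forall n (theta : formula L n.+1) (b : 'I_n -> rnd_Omega -> M),
    (forall i, rnd_K (b i)) ->
    exists2 a : rnd_Omega -> M, rnd_K a &
      truth_set theta (scons a b) = truth_set (Ex theta) b }.

Variable K : randomization.

Definition rnd_sortB : Type := {E : set (rnd_Omega K) | measurable E}.
Definition rnd_sortK : Type := {a : rnd_Omega K -> M | rnd_K a}.

Definition rnd_event n (psi : formula L n) (a : 'I_n -> rnd_sortK) : rnd_sortB :=
  exist _ _ (rnd_measurable psi (fun i => svalP (a i))).

Definition rnd_mu (E : rnd_sortB) : R := fine (rnd_prob K (sval E)).

Definition rnd_interp : interpretation R L := {|
  sortK := rnd_sortK;
  sortB := rnd_sortB;
  event := rnd_event;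
  mu := rnd_mu;
  etop := exist _ setT measurableT;
  ebot := exist _ set0 measurable0;
  emeet := fun E F : rnd_sortB => exist _ _ (measurableI _ _ (svalP E) (svalP F));
  ejoin := fun E F : rnd_sortB => exist _ _ (measurableU _ _ (svalP E) (svalP F));
  ecompl := fun E : rnd_sortB => exist _ _ (measurableC (svalP E));
  distK := fun a b : rnd_sortK =>
    rnd_mu (rnd_event (Neg (Eq (Var ord0) (Var ord_max)))
                      (fun i : 'I_2 => if i == ord0 then a else b));
  distB := fun E F : rnd_sortB => fine (rnd_prob K (sval E `+` sval F)) |}.

(* The remaining clause in the definition of a nice randomization: its
   reduction is already complete. *)
Definition nice : Prop :=
  complete_dist (@distK R L rnd_interp) /\
  complete_dist (@distB R L rnd_interp).

End RandomizationData.

Definition rnd_theory (R : realType) (L : signature) (T : theory L) :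
    set (csentence R L) :=
  [set s | forall M : structure L, models M T ->
           forall K : randomization R M, nice K -> ctrue (rnd_interp K) s].

(* The models of T^R; [metric_structure] includes that the two distances are
   complete metrics, not just pseudometrics. *)
Definition rnd_model (R : realType) (L : signature) (T : theory L)
    (N : interpretation R L) : Prop :=
  metric_structure N /\ (forall s, rnd_theory T s -> ctrue N s).

Section Definability.
Variables (R : realType) (L : signature) (N : interpretation R L).
Variable A : set (sortK N).

Definition noenv (X : Type) : 'I_0 -> X :=
  fun i => False_rect X (notF (ltn_ord i)).

Definition definableK (b : sortK N) : Prop :=
  exists (n : nat -> nat) (Phi : forall k, cformula R L (n k).+1 0)
         (a : forall k, 'I_(n k) -> sortK N),
    (forall k i, A (a k i)) /\
    forall eps : R, 0 < eps -> \forall k \near \oo, forall x : sortK N,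
      `|value (Phi k) (scons x (a k)) (@noenv _) - distK x b| < eps.

Definition definableB (E : sortB N) : Prop :=
  exists (n : nat -> nat) (Phi : forall k, cformula R L (n k) 1)
         (a : forall k, 'I_(n k) -> sortK N),
    (forall k i, A (a k i)) /\
    forall eps : R, 0 < eps -> \forall k \near \oo, forall X : sortB N,
      `|value (Phi k) (a k) (fun=> X) - distB X E| < eps.

Definition fo_definable_on (T : theory L) (E : sortB N) (b : sortK N) : Prop :=
  exists (n : nat) (phi : formula L n.+1) (a : 'I_n -> sortK N),
    [/\ functional T phi, forall i, A (a i) & E = event phi (scons b a)].

End Definability.

(* Main.v *)
(* The heart of the matter is a form of quantifier elimination for
   randomizations: the value of a continuous formula at a tuple depends only on
   the joint distribution of the truth values of finitely many first-order
   formulas.  For a quantifier over random elements this holds because a finite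
   partition can be subdivided in any prescribed proportions (Sierpinski's
   theorem for atomless measures), and witnesses chosen on the pieces can be
   glued.

   Now let Phi(x, a) be within eps of d(x, b), and let Theta be the finitely many
   formulas that determine Phi.  Move b, at every sample point where this is
   possible, to another element having the same Theta-pattern over a, and call
   the result b'.  Then Phi(b', a) = Phi(b, a), so d(b', b) is of order eps,
   which means that, up to an event of measure of order eps, b is the only
   element with its pattern.  "Being the only element with pattern S" is a
   functional formula.  All of this is expressed by a continuous sentence, which
   is checked in nice randomizations and holds in N because N is a model of T^R.

   In the other direction, x and b differ on E_n = [[phi_n(b, a_n)]] exactly
   where phi_n(x, a_n) fails, and a definable event or element can be replaced
   by a bound variable, the infimum penalizing its distance to that event or
   element. *)
Require Import Defs.
From mathcomp Require Import all_boot all_order all_algebra.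
From mathcomp Require Import all_classical all_reals all_analysis.
From mathcomp Require Import lra.
Set Implicit Arguments.
Unset Strict Implicit.
Unset Printing Implicit Defensive.
Import Order.TTheory GRing.Theory Num.Theory.
Import numFieldNormedType.Exports.
Local Open Scope classical_set_scope.
Local Open Scope ring_scope.

(** * Renaming of variables, and bounds *)

Definition comp_env (X : Type) n m (r : 'I_n -> 'I_m) (e : 'I_m -> X) :
  'I_n -> X := fun i => e (r i).

Definition lift_ren n m (r : 'I_n -> 'I_m) : 'I_n.+1 -> 'I_m.+1 :=
  scons ord0 (fun i => lift ord0 (r i)).

Lemma scons0 (X : Type) n (x : X) (e : 'I_n -> X) : scons x e ord0 = x.
Proof. by rewrite /scons unlift_none. Qed.

Lemma sconsS (X : Type) n (x : X) (e : 'I_n -> X) i :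
  scons x e (lift ord0 i) = e i.
Proof. by rewrite /scons liftK. Qed.

Lemma scons_map (X Y : Type) (f : X -> Y) n (x : X) (e : 'I_n -> X) :
  (fun i => f (scons x e i)) = scons (f x) (fun i => f (e i)).
Proof.
by apply/funext => i; rewrite /scons; case: (unlift ord0 i).
Qed.

Lemma comp_env_lift (X : Type) n m (r : 'I_n -> 'I_m) (x : X) e :
  comp_env (lift_ren r) (scons x e) = scons x (comp_env r e).
Proof.
apply/funext => i; rewrite /comp_env /lift_ren; case: (unliftP ord0 i) => [j|] ->.
  by rewrite !sconsS.
by rewrite !scons0.
Qed.

Section Renaming.
Variable L : signature.

Fixpoint tren n m (r : 'I_n -> 'I_m) (t : term L n) : term L m :=
  match t with
  | Var i => Var (r i)
  | App f ts => App (fun i => tren r (ts i))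
  end.

Fixpoint fren n (phi : formula L n) : forall m, ('I_n -> 'I_m) -> formula L m :=
  match phi in formula _ n return forall m, ('I_n -> 'I_m) -> formula L m with
  | Eq _ t1 t2 => fun m r => Eq (tren r t1) (tren r t2)
  | Rel _ s ts => fun m r => Rel (fun i => tren r (ts i))
  | Neg _ phi => fun m r => Neg (fren phi r)
  | And _ phi psi => fun m r => And (fren phi r) (fren psi r)
  | Or _ phi psi => fun m r => Or (fren phi r) (fren psi r)
  | Ex _ phi => fun m r => Ex (fren phi (lift_ren r))
  | All _ phi => fun m r => All (fren phi (lift_ren r))
  end.

Lemma teval_tren (M : structure L) n m (r : 'I_n -> 'I_m) (e : 'I_m -> M) t :
  teval e (tren r t) = teval (comp_env r e) t.
Proof.
elim: t => //= f ts IH; congr finterp; apply/funext => i; exact: IH.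
Qed.

Lemma sat_fren (M : structure L) n (phi : formula L n) m (r : 'I_n -> 'I_m)
    (e : 'I_m -> M) :
  sat (fren phi r) e <-> sat phi (comp_env r e).
Proof.
elim: phi m r e => {n} /=.
- by move=> n t1 t2 m r e; rewrite !teval_tren.
- move=> n s ts m r e.
  suff -> : (fun i => teval e (tren r (ts i)))
    = (fun i => teval (comp_env r e) (ts i)) by [].
  by apply/funext => i; rewrite teval_tren.
- by move=> n phi IH m r e; rewrite IH.
- by move=> n phi IH1 psi IH2 m r e; rewrite IH1 IH2.
- by move=> n phi IH1 psi IH2 m r e; rewrite IH1 IH2.
- by move=> n phi IH m r e; split=> -[x]; [rewrite IH comp_env_lift|
    rewrite -comp_env_lift -IH]; exists x.
- by move=> n phi IH m r e; split=> h x; [rewrite -comp_env_lift -IH|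
    rewrite IH comp_env_lift].
Qed.

Fixpoint eren k b k' b' (rK : 'I_k -> 'I_k') (rB : 'I_b -> 'I_b')
    (t : eterm L k b) : eterm L k' b' :=
  match t with
  | EVar j => EVar L k' (rB j)
  | EEvent _ phi x => EEvent b' phi (fun i => rK (x i))
  | ETop => ETop L k' b'
  | EBot => EBot L k' b'
  | EMeet t1 t2 => EMeet (eren rK rB t1) (eren rK rB t2)
  | EJoin t1 t2 => EJoin (eren rK rB t1) (eren rK rB t2)
  | ECompl t => ECompl (eren rK rB t)
  end.

Variable R : realType.

Fixpoint cren k b (Phi : cformula R L k b) :
    forall k' b', ('I_k -> 'I_k') -> ('I_b -> 'I_b') -> cformula R L k' b' :=
  match Phi in cformula _ _ k b
      return forall k' b', ('I_k -> 'I_k') -> ('I_b -> 'I_b') ->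
        cformula R L k' b' with
  | CMu _ _ t => fun k' b' rK rB => CMu R (eren rK rB t)
  | CDistB _ _ t1 t2 => fun k' b' rK rB => CDistB R (eren rK rB t1) (eren rK rB t2)
  | CDistK _ _ x y => fun k' b' rK rB => CDistK R L b' (rK x) (rK y)
  | CConn _ _ _ u Phi => fun k' b' rK rB => CConn u (fun i => cren (Phi i) rK rB)
  | CSupK _ _ Phi => fun k' b' rK rB => CSupK (cren Phi (lift_ren rK) rB)
  | CInfK _ _ Phi => fun k' b' rK rB => CInfK (cren Phi (lift_ren rK) rB)
  | CSupB _ _ Phi => fun k' b' rK rB => CSupB (cren Phi rK (lift_ren rB))
  | CInfB _ _ Phi => fun k' b' rK rB => CInfB (cren Phi rK (lift_ren rB))
  end.

Variable N : interpretation R L.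

Lemma eeval_eren k b k' b' (rK : 'I_k -> 'I_k') (rB : 'I_b -> 'I_b') t
    (eK : 'I_k' -> sortK N) (eB : 'I_b' -> sortB N) :
  eeval eK eB (eren rK rB t) = eeval (comp_env rK eK) (comp_env rB eB) t.
Proof. by elim: t => //= [? -> ? ->|? -> ? ->|? ->]. Qed.

Lemma value_cren k b (Phi : cformula R L k b) k' b'
    (rK : 'I_k -> 'I_k') (rB : 'I_b -> 'I_b')
    (eK : 'I_k' -> sortK N) (eB : 'I_b' -> sortB N) :
  value (cren Phi rK rB) eK eB = value Phi (comp_env rK eK) (comp_env rB eB).
Proof.
elim: Phi k' b' rK rB eK eB => {k b} //=.
- by move=> *; rewrite eeval_eren.
- by move=> *; rewrite !eeval_eren.
- move=> k b n u Phi IH k' b' rK rB eK eB; congr (conn_fun u _).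
  by apply/rowP => i; rewrite !mxE IH.
- move=> k b Phi IH *; congr sup; congr (_ @` _); apply/funext => x.
  by rewrite IH comp_env_lift.
- move=> k b Phi IH *; congr inf; congr (_ @` _); apply/funext => x.
  by rewrite IH comp_env_lift.
- move=> k b Phi IH *; congr sup; congr (_ @` _); apply/funext => x.
  by rewrite IH comp_env_lift.
- move=> k b Phi IH *; congr inf; congr (_ @` _); apply/funext => x.
  by rewrite IH comp_env_lift.
Qed.

(* Enough of [pre_structure] for all suprema and infima to be taken over
   nonempty bounded sets. *)
Definition bounded_interp : Prop :=
  [/\ inhabited (sortK N), forall E : sortB N, 0 <= mu E <= 1,
      forall x y : sortK N, 0 <= distK x y <= 1
    & forall E F : sortB N, 0 <= distB E F <= 1].

Lemma sup_range01 (X : Type) (f : X -> R) :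
  inhabited X -> (forall x, 0 <= f x <= 1) -> 0 <= sup (range f) <= 1.
Proof.
move=> [x0] h; apply/andP; split.
  apply: (@le_trans _ _ (f x0)); first by case/andP: (h x0).
  by apply: ub_le_sup; [exists 1 => _ [x _ <-]; case/andP: (h x)|exists x0].
by apply: ge_sup => [|_ [x _ <-]]; [exists (f x0); exists x0|case/andP: (h x)].
Qed.

Lemma inf_range01 (X : Type) (f : X -> R) :
  inhabited X -> (forall x, 0 <= f x <= 1) -> 0 <= inf (range f) <= 1.
Proof.
move=> [x0] h; apply/andP; split; last first.
  apply: (@le_trans _ _ (f x0)); last by case/andP: (h x0).
  by apply: ge_inf; [exists 0 => _ [x _ <-]; case/andP: (h x)|exists x0].
by apply: lb_le_inf => [|_ [x _ <-]]; [exists (f x0); exists x0|case/andP: (h x)].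
Qed.

Lemma value01 k b (Phi : cformula R L k b) eK eB :
  bounded_interp -> 0 <= value (N := N) Phi eK eB <= 1.
Proof.
case=> hK hmu hdK hdB.
have hB : inhabited (sortB N) by exists; exact: etop.
elim: Phi eK eB => {k b} //=.
- move=> k b n u Phi IH eK eB; apply: conn_range => i; rewrite mxE; exact: IH.
- by move=> k b Phi IH eK eB; apply: sup_range01.
- by move=> k b Phi IH eK eB; apply: inf_range01.
- by move=> k b Phi IH eK eB; apply: sup_range01.
- by move=> k b Phi IH eK eB; apply: inf_range01.
Qed.

Lemma sup_range_eq0 (X : Type) (f : X -> R) :
  inhabited X -> (forall x, 0 <= f x <= 1) ->
  sup (range f) = 0 <-> forall x, f x = 0.
Proof.
move=> [x0] h; split=> [h0 x|h0].
  apply/le_anti; case/andP: (h x) => -> _; rewrite andbT -h0.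
  by apply: ub_le_sup; [exists 1 => _ [y _ <-]; case/andP: (h y)|exists x].
have -> : range f = [set 0].
  by apply/seteqP; split=> [_ [x _ <-]|_ ->]; [exact: h0|exists x0].
exact: sup1.
Qed.

Lemma inf_range_eq0 (X : Type) (f : X -> R) :
  inhabited X -> (forall x, 0 <= f x <= 1) ->
  inf (range f) = 0 <-> forall eps, 0 < eps -> exists x, f x < eps.
Proof.
move=> [x0] h; have hi : has_inf (range f).
  by split; [exists (f x0); exists x0|exists 0 => _ [x _ <-]; case/andP: (h x)].
split=> [h0 eps e0|h0].
  have [_ [x _ <-]] := inf_adherent e0 hi.
  by rewrite h0 add0r; exists x.
apply/le_anti/andP; split; last first.
  by apply: lb_le_inf => [|_ [x _ <-]]; [exact: hi.1|case/andP: (h x)].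
apply/ler_addgt0Pr => eps e0; rewrite add0r.
have [x hx] := h0 _ e0; apply: le_trans (ltW hx).
by apply: ge_inf; [exact: hi.2|exists x].
Qed.

End Renaming.

(** * Transfer from nice randomizations to models of T^R *)

Section Connectives.
Variable R : realType.

(** One connective covers two cases: on values in [0,1], [q = 1] gives the truncated sum and
    [q = -1] the absolute difference. *)
Definition lin2 (q : R) (v : 'rV[R]_2) : R :=
  Num.min 1 `|v 0 ord0 + q * v 0 ord_max|.

Lemma lin2_range q v : cube v -> 0 <= lin2 q v <= 1.
Proof. by move=> _; rewrite /lin2 le_min ler01 normr_ge0 ge_min lexx. Qed.

Lemma lin2_continuous q : {within @cube R 2, continuous (lin2 q)}.
Proof.
apply: continuous_subspaceT => v; rewrite /lin2.
apply: (@continuous_min _ _ (fun=> 1) (fun v : 'rV[R]_2 => `|_|)).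
  exact: cst_continuous.
apply: (@continuous_comp _ _ _ (fun v : 'rV[R]_2 => v 0 ord0 + q * v 0 ord_max)
  Num.norm); last exact: norm_continuous.
apply: continuousD; first exact: coord_continuous.
apply: continuousM; [exact: cst_continuous|exact: coord_continuous].
Qed.

Definition clin2 (q : R) (L : signature) k b (Phi Psi : cformula R L k b) :
    cformula R L k b :=
  CConn (Connective (@lin2_range q) (@lin2_continuous q))
        (fun i : 'I_2 => if i == ord0 then Phi else Psi).

Lemma value_clin2 q L (N : interpretation R L) k b (Phi Psi : cformula R L k b)
    eK eB :
  value (N := N) (clin2 q Phi Psi) eK eB
  = Num.min 1 `|value Phi eK eB + q * value Psi eK eB|.
Proof. by rewrite /= /lin2 !mxE. Qed.

End Connectives.

Notation cadd := (clin2 1).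
Notation cdiff := (clin2 (- 1)).

Section BoundedValues.
Variables (R : realType) (L : signature) (N : interpretation R L).
Hypothesis bN : bounded_interp N.
Variables (k b : nat).
Implicit Type Phi Psi : cformula R L k b.

Lemma value_cadd Phi Psi eK eB :
  value (N := N) (cadd Phi Psi) eK eB
  = Num.min 1 (value Phi eK eB + value Psi eK eB).
Proof.
rewrite value_clin2 mul1r ger0_norm // addr_ge0 //.
  by case/andP: (value01 Phi eK eB bN).
by case/andP: (value01 Psi eK eB bN).
Qed.

Lemma value_cdiff Phi Psi eK eB :
  value (N := N) (cdiff Phi Psi) eK eB = `|value Phi eK eB - value Psi eK eB|.
Proof.
rewrite value_clin2 mulN1r min_r // ler_norml.
by have := value01 Phi eK eB bN; have := value01 Psi eK eB bN; lra.
Qed.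

End BoundedValues.

(** Truth means value 0 and all values are nonnegative, so a prefix of suprema acts as a universal
    closure. *)
Fixpoint closeK (R : realType) (L : signature) k b :
    cformula R L k b -> cformula R L 0 b :=
  if k is k'.+1 then fun Phi => closeK (CSupK Phi) else fun Phi => Phi.

Fixpoint closeB (R : realType) (L : signature) k b :
    cformula R L k b -> cformula R L k 0 :=
  if b is b'.+1 then fun Phi => closeB (CSupB Phi) else fun Phi => Phi.

Lemma scons_eta (X : Type) n (e : 'I_n.+1 -> X) :
  e = scons (e ord0) (fun i => e (lift ord0 i)).
Proof.
apply/funext => i; case: (unliftP ord0 i) => [j|] ->.
  by rewrite sconsS.
by rewrite scons0.
Qed.

Lemma closeK_eq0 (R : realType) (L : signature) (N : interpretation R L)
    (bN : bounded_interp N) k b (Phi : cformula R L k b) eB :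
  (forall eK : 'I_0 -> sortK N, value (closeK Phi) eK eB = 0)
  <-> forall eK : 'I_k -> sortK N, value Phi eK eB = 0.
Proof.
elim: k Phi => [|k IH] Phi //=; rewrite IH /=.
have hK : inhabited (sortK N) by case: bN.
split=> [h eK|h eK].
  rewrite (scons_eta eK); move: (h (fun i => eK (lift ord0 i))).
  move/(sup_range_eq0 hK) => ->// x.
  exact: value01.
by apply/(sup_range_eq0 hK) => [x|x]; [exact: value01|exact: h].
Qed.

Lemma closeB_eq0 (R : realType) (L : signature) (N : interpretation R L)
    (bN : bounded_interp N) k b (Phi : cformula R L k b) eK :
  (forall eB : 'I_0 -> sortB N, value (closeB Phi) eK eB = 0)
  <-> forall eB : 'I_b -> sortB N, value Phi eK eB = 0.
Proof.
elim: b Phi => [|b IH] Phi //=; rewrite IH /=.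
have hB : inhabited (sortB N) by exists; exact: etop.
split=> [h eB|h eB].
  rewrite (scons_eta eB); move: (h (fun i => eB (lift ord0 i))).
  move/(sup_range_eq0 hB) => ->// x.
  exact: value01.
by apply/(sup_range_eq0 hB) => [x|x]; [exact: value01|exact: h].
Qed.

Lemma ctrue_close (R : realType) (L : signature) (N : interpretation R L)
    (bN : bounded_interp N) k b (Phi : cformula R L k b) :
  ctrue N (closeK (closeB Phi))
  <-> forall eK eB, value (N := N) Phi eK eB = 0.
Proof.
split=> h eK eB.
  move: eB; apply/(closeB_eq0 bN) => eB.
  by move: eK; apply/(closeK_eq0 bN) => eK; exact: h.
move: eK; apply/(closeK_eq0 bN) => eK.
by move: eB; apply/(closeB_eq0 bN) => eB; exact: h.
Qed.

Lemma pre_structure_bounded (R : realType) (L : signature)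
    (N : interpretation R L) : pre_structure N -> bounded_interp N.
Proof. by move=> pN; split; case: pN => // ? [] ? ? ? ? []. Qed.

Lemma fine_prob01 (R : realType) d (Omega : measurableType d)
    (P : probability Omega R) (E : set Omega) :
  measurable E -> 0 <= fine (P E) <= 1.
Proof.
move=> mE; have := probability_le1 P mE; have : (0 <= P E)%E by [].
by case: (P E) => [r| |] //=; rewrite !lee_fin => -> ->.
Qed.

Lemma rnd_bounded (R : realType) (L : signature) (M : structure L)
    (K : randomization R M) : bounded_interp (rnd_interp K).
Proof.
split=> /=.
- have [x] := carrier_inhabited M.
  (* An element of [rnd_K] comes from the witness clause for the formula [u = u] with an empty tuple
     of parameters. *)
  have [i|a Ka _] := @rnd_witness _ _ _ K 0 (Eq (Var ord0) (Var ord0))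
    (fun i => fun=> x); last by exists; exists a.
  by case: i.
- by move=> E; apply: fine_prob01; exact: svalP.
- by move=> x y; exact: fine_prob01 (svalP (rnd_event _ _)).
- move=> E F; apply: fine_prob01; apply: measurableU; apply: measurableD;
  exact: svalP.
Qed.

(** * Identities between events, checked at each sample point and transferred *)

Section PointwiseTruth.
Variables (R : realType) (L : signature).

(** [B j] tells whether the sample point under consideration lies in the j-th event variable. *)
Fixpoint holds_at (M : structure L) k b (v : 'I_k -> M) (B : 'I_b -> Prop)
    (t : eterm L k b) : Prop :=
  match t with
  | EVar j => B j
  | EEvent _ phi x => sat phi (fun i => v (x i))
  | ETop => True
  | EBot => False
  | EMeet t1 t2 => holds_at v B t1 /\ holds_at v B t2
  | EJoin t1 t2 => holds_at v B t1 \/ holds_at v B t2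
  | ECompl t => ~ holds_at v B t
  end.

Definition valid (T : theory L) k b (P : forall M : structure L,
    ('I_k -> M) -> ('I_b -> Prop) -> Prop) :=
  forall M : structure L, models M T -> forall v B, P M v B.

Lemma rnd_eevalE (M : structure L) (K : randomization R M) k b
    (eK : 'I_k -> sortK (rnd_interp K)) (eB : 'I_b -> sortB (rnd_interp K)) t w :
  sval (eeval eK eB t) w
  = holds_at (fun i => sval (eK i) w) (fun j => sval (eB j) w) t.
Proof.
by elim: t => //= [t1 <- t2 <-|t1 <- t2 <-|t <-].
Qed.

Variables (T : theory L) (N : interpretation R L).
Hypothesis N_model : rnd_model T N.

Let bN : bounded_interp N := pre_structure_bounded (ms_pre N_model.1).

(** The universal closure of the condition [Phi = 0] is a sentence of [rnd_theory T], hence true in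
    [N]. *)
Lemma transfer k b (Phi : cformula R L k b) :
  (forall (M : structure L), models M T -> forall K : randomization R M,
     forall eK eB, value (N := rnd_interp K) Phi eK eB = 0) ->
  forall eK eB, value (N := N) Phi eK eB = 0.
Proof.
move=> h; apply/(ctrue_close bN); apply: N_model.2 => M TM K _.
by apply/(ctrue_close (rnd_bounded K)) => eK eB; exact: h.
Qed.

(** In a randomization the two events have empty symmetric difference. The distance 0 transfers to
    [N], where distance 0 means equality. *)
Lemma eeval_eq k b (t1 t2 : eterm L k b) eK eB :
  valid T (fun M v B => holds_at v B t1 <-> holds_at v B t2) ->
  eeval (N := N) eK eB t1 = eeval eK eB t2.
Proof.
move=> h; apply: (ms_sepB N_model.1).
apply: (transfer (Phi := CDistB R t1 t2)) => M TM K eK' eB' /=.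
suff -> : sval (eeval eK' eB' t1) = sval (eeval eK' eB' t2).
  by rewrite setYK measure0.
by apply/funext => w; rewrite !rnd_eevalE; apply/propext; exact: h.
Qed.

(** Additivity must be expressed with connectives valued in [0,1]. The truncated sum ([h1]) loses
    information once the sum exceeds 1, and the absolute difference ([h2]) leaves a sign open.
    Together they suffice: if the truncation is active, then the left side is 1 and the sign is
    positive. *)
Lemma mu_additive k b (t t1 t2 : eterm L k b) eK eB :
  valid T (fun M v B => (holds_at v B t <-> holds_at v B t1 \/ holds_at v B t2)
    /\ ~ (holds_at v B t1 /\ holds_at v B t2)) ->
  mu (eeval (N := N) eK eB t) = mu (eeval eK eB t1) + mu (eeval eK eB t2).
Proof.
move=> h.
have add (M : structure L) : models M T -> forall (K : randomization R M)
    (eK : 'I_k -> sortK (rnd_interp K)) (eB : 'I_b -> sortB (rnd_interp K)),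
    mu (eeval eK eB t) = mu (eeval eK eB t1) + mu (eeval eK eB t2).
  move=> TM K eK' eB' /=; rewrite /rnd_mu.
  rewrite -fineD ?fin_num_measure //; try exact: svalP.
  rewrite -measureU; try exact: svalP.
    congr (fine (_ _)); apply/funext => w; apply/propext => /=.
    by rewrite /setU/= !rnd_eevalE; case: (h M TM
      (fun i => sval (eK' i) w) (fun j => sval (eB' j) w)).
  apply/seteqP; split=> w //=; rewrite /setI /= !rnd_eevalE.
  by case: (h M TM (fun i => sval (eK' i) w) (fun j => sval (eB' j) w)).
have h1 : mu (eeval (N := N) eK eB t)
    = Num.min 1 (mu (eeval eK eB t1) + mu (eeval eK eB t2)).
  have := @transfer _ _ (cdiff (CMu R t) (cadd (CMu R t1) (CMu R t2))) _ eK eB.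
  rewrite value_cdiff // value_cadd // => H.
  apply/eqP; rewrite -subr_eq0 -normr_eq0; apply/eqP; apply: H => M TM K eK' eB'.
  have bK := rnd_bounded K.
  rewrite value_cdiff // value_cadd // min_r -/(value _ _ _).
    by rewrite -(add M TM K eK' eB') subrr normr0.
  rewrite -(add M TM K eK' eB').
  by case/andP: (value01 (CMu R t) eK' eB' bK).
have h2 : `|mu (eeval (N := N) eK eB t) - mu (eeval eK eB t1)|
    = mu (eeval eK eB t2).
  have := @transfer _ _ (cdiff (cdiff (CMu R t) (CMu R t1)) (CMu R t2)) _ eK eB.
  rewrite !value_cdiff // => H.
  apply/eqP; rewrite -subr_eq0 -normr_eq0; apply/eqP; apply: H => M TM K eK' eB'.
  have bK := rnd_bounded K.
  rewrite !value_cdiff // -/(value _ _ _).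
  have -> : value (CMu R t) eK' eB'
    = value (CMu R t1) eK' eB' + value (CMu R t2) eK' eB'.
    exact: add M TM K eK' eB'.
  rewrite [X in `| `|X| - _|]addrAC subrr add0r.
  have /andP[t2_ge0 _] := value01 (CMu R t2) eK' eB' bK.
  by rewrite (ger0_norm t2_ge0) subrr normr0.
case: bN => _ m01 _ _.
move: h1 h2 (m01 (eeval eK eB t)) (m01 (eeval eK eB t1)) (m01 (eeval eK eB t2)).
by rewrite minEle; case: ifP => _; case: (ger0P (_ - mu (eeval eK eB t1))); lra.
Qed.

End PointwiseTruth.

(** * Subdividing atomless probability spaces *)

Section Sierpinski.
Context {d : measure_display} {Omega : measurableType d} {R : realType}.
Variable P : probability Omega R.

Definition pr (A : set Omega) : R := fine (P A).

Lemma prE A : measurable A -> P A = (pr A)%:E.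
Proof. by move=> mA; rewrite fineK ?fin_num_measure. Qed.

Lemma pr_ge0 A : 0 <= pr A.
Proof. exact: fine_ge0. Qed.

Lemma prU A B : measurable A -> measurable B -> A `&` B = set0 ->
  pr (A `|` B) = pr A + pr B.
Proof.
by move=> mA mB AB; rewrite /pr measureU // fineD ?fin_num_measure.
Qed.

Lemma prID A B : measurable A -> measurable B ->
  pr A = pr (A `&` B) + pr (A `\` B).
Proof.
move=> mA mB; rewrite -prU; first by rewrite setUIDK.
- exact: measurableI.
- exact: measurableD.
- by apply/seteqP; split=> w //= [[_ ?] []].
Qed.

Lemma pr_setD A B : measurable A -> measurable B -> B `<=` A ->
  pr (A `\` B) = pr A - pr B.
Proof.
by move=> mA mB BA; rewrite (prID mA mB) setIidr // addrC addKr.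
Qed.

Lemma le_pr A B : measurable A -> measurable B -> A `<=` B -> pr A <= pr B.
Proof.
by move=> mA mB AB; rewrite -subr_ge0 -pr_setD // pr_ge0.
Qed.

Hypothesis P_atomless : atomless P.

(** Of a proper piece and its complement in [A], one has at most half the measure. *)
Lemma atomless_halving A : measurable A -> 0 < pr A ->
  exists B, [/\ measurable B, B `<=` A & 0 < pr B <= pr A / 2].
Proof.
move=> mA A0.
have [|F [mF FA]] := P_atomless mA; first by rewrite prE ?lte_fin.
rewrite !prE // !lte_fin => F0 FltA.
have := pr_setD mA mF FA.
have [hF|hF] := leP (pr F) (pr A / 2) => e.
  by exists F; split=> //; lra.
exists (A `\` F); split; [exact: measurableD|exact: subDsetl|].
by rewrite e; lra.
Qed.

Lemma atomless_small A eps : measurable A -> 0 < pr A -> 0 < eps ->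
  exists B, [/\ measurable B, B `<=` A & 0 < pr B <= eps].
Proof.
move=> mA A0 e0.
have iter n : exists B, [/\ measurable B, B `<=` A & 0 < pr B <= pr A / 2 ^+ n].
  elim: n => [|n [B [mB BA /andP[B0 hB]]]].
    by exists A; split=> //; rewrite A0 expr0 divr1 lexx.
  have [C [mC CB /andP[C0 hC]]] := atomless_halving mB B0.
  exists C; split=> //; first exact: subset_trans CB BA.
  by rewrite C0 (le_trans hC) // exprSr invfM mulrA ler_pM2r // invr_gt0.
have [n hn] : exists n : nat, pr A / eps < n%:R.
  exists (Num.bound (pr A / eps)); apply: le_lt_trans (archi_boundP _).
    exact: lexx.
  by rewrite divr_ge0 ?ltW.
have [B [mB BA /andP[B0 hB]]] := iter n.
exists B; split=> //; rewrite B0 (le_trans hB) //.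
rewrite ler_pdivrMr ?exprn_gt0 // mulrC -ler_pdivrMr //.
rewrite (le_trans (ltW hn)) // -natrX ler_nat ltnW //; exact: ltn_expl.
Qed.

(** Greedy exhaustion: starting from the empty set, sets that keep the total at most [r] are added
    one after the other, each nearly as large as possible. The union turns out to have measure
    exactly [r]. *)
Theorem atomless_sierpinski A r : measurable A -> 0 <= r <= pr A ->
  exists B, [/\ measurable B, B `<=` A & pr B = r].
Proof.
move=> mA /andP[r0 rA].
pose ok F := [/\ measurable F, F `<=` A & pr F <= r].
pose adm F G := [/\ measurable G, G `<=` A `\` F & pr F + pr G <= r].
have ok_step F G : ok F -> adm F G -> ok (F `|` G).
  move=> [mF FA Fr] [mG GA Gr]; split; first exact: measurableU.
  - by move=> w [/FA|/GA[]].
  - rewrite prU //; apply/seteqP; split=> w // [Fw /GA[_]]; exact.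
(* Each step adds a set at least half as large as any admissible one. *)
have greedy F : ok F -> exists G, adm F G /\ forall G', adm F G' -> pr G' <= 2 * pr G.
  move=> [mF FA Fr].
  pose S := [set pr G | G in adm F].
  have adm0 : adm F set0.
    by split; [exact: measurable0|exact: sub0set|rewrite /pr measure0 /= addr0].
  have hS : has_sup S.
    split; first by exists (pr set0); exists set0.
    by exists r => _ [G [_ _ h] <-]; have := pr_ge0 F; lra.
  have S_ub G' : adm F G' -> pr G' <= sup S.
    by move=> aG; apply: ub_le_sup; [exact: hS.2|exists G'].
  have [s0|s0] := leP (sup S) 0.
    exists set0; split=> // G' /S_ub h; have := pr_ge0 set0; lra.
  have s2 : 0 < sup S / 2 by rewrite divr_gt0.
  have [_ [G aG <-] hG] := sup_adherent s2 hS.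
  by exists G; split=> // G' /S_ub; lra.
have /choice[g gP] : forall F, exists G, ok F -> adm F G /\
    forall G', adm F G' -> pr G' <= 2 * pr G.
  move=> F.
  have [/greedy[G hG]|nF] := pselect (ok F); first by exists G.
  by exists set0.
pose F := fix F n := if n is n'.+1 then F n' `|` g (F n') else set0.
have okF n : ok (F n).
  elim: n => [|n IH] /=; last by apply: ok_step => //; exact: (gP _ IH).1.
  by split; [exact: measurable0|exact: sub0set|rewrite /pr measure0].
have mF n : measurable (F n) by case: (okF n).
pose B := \bigcup_n F n.
have mB : measurable B by exact: bigcupT_measurable.
have BA : B `<=` A by move=> w [n _]; case: (okF n) => _ h _ /h.
have cvgB : pr \o F @ \oo --> pr B.
  apply: fine_cvg; rewrite fineK ?fin_num_measure //.
  apply: nondecreasing_cvg_mu => //.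
  apply/nondecreasing_seqP => n; apply/subsetPset; exact: subsetUl.
have Br : pr B <= r.
  apply: cvgr_to_le cvgB _.
  by apply: nearW => n; case: (okF n).
exists B; split=> //; apply/le_anti; rewrite Br /= leNgt; apply/negP => Blt.
(* If [B] fell short of [r], a small piece [G] of the remainder would be admissible at every stage.
   Each stage would then add at least [pr G / 2], and the measures would exceed [r]. *)
have [|||G [mG GA /andP[G0 hG]]] := @atomless_small (A `\` B) (r - pr B).
- exact: measurableD.
- by rewrite pr_setD //; lra.
- by rewrite subr_gt0.
have admG n : adm (F n) G.
  split=> //.
    by move=> w /GA[Aw nBw]; split=> // Fw; apply: nBw; exists n.
  have : pr (F n) <= pr B by apply: le_pr => // w Fw; exists n.
  lra.
have grow n : n%:R * (pr G / 2) <= pr (F n).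
  elim: n => [|n IH]; first by rewrite mul0r pr_ge0.
  have [[mg gA _] /(_ G (admG n)) h] := gP _ (okF n).
  rewrite [F _]/= prU //; last first.
    by apply/seteqP; split=> w // [Fw /gA[_]]; exact.
  by rewrite -natr1 mulrDl mul1r lerD //; lra.
have [n hn] : exists n : nat, r / (pr G / 2) < n%:R.
  exists (Num.bound (r / (pr G / 2))); apply: le_lt_trans (archi_boundP _).
    exact: lexx.
  by rewrite !divr_ge0 // ltW.
have := grow n; rewrite ltr_pdivrMr ?divr_gt0 // in hn.
by case: (okF n) => _ _; lra.
Qed.

Definition fin_measurable (F : finType) (f : Omega -> F) : Prop :=
  forall x, measurable (f @^-1` [set x]).

Lemma fin_measurable_pred (F : finType) (f : Omega -> F) (h : pred F) :
  fin_measurable f -> measurable [set w | h (f w)].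
Proof.
move=> mf.
have -> : [set w | h (f w)] = \bigcup_(x in [set x | h x]) f @^-1` [set x].
  apply/seteqP; split=> [w hw|w [x hx fx]]; first by exists (f w).
    by rewrite /= fx.
by apply: fin_bigcup_measurable => // x _; exact: mf.
Qed.

(** Equality is tested on predicates rather than on points, so that it passes at once to any
    function of [f] and [g]. *)
Definition same_law (F : finType) (f g : Omega -> F) : Prop :=
  forall h : pred F, pr [set w | h (f w)] = pr [set w | h (g w)].

Lemma pr_fiber_sum (F : finType) (f : Omega -> F) (A : set Omega) :
  fin_measurable f -> measurable A ->
  pr A = \sum_(x : F) pr (A `&` f @^-1` [set x]).
Proof.
move=> mf mA.
have key (s : seq F) : uniq s -> pr (A `&` [set w | f w \in s])
    = \sum_(x <- s) pr (A `&` f @^-1` [set x]).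
  elim: s => [_|x s IH /= /andP[xs us]].
    rewrite big_nil (_ : _ `&` _ = set0) ?/pr ?measure0 //.
    by apply/seteqP; split=> w // [].
  rewrite big_cons -IH // -prU.
  - congr pr; apply/seteqP; split=> w /=.
      by case=> Aw; rewrite inE => /orP[/eqP|]; [left|right].
    by case=> -[Aw h]; split=> //; rewrite inE; [rewrite h eqxx|rewrite h orbT].
  - by apply: measurableI => //; exact: mf.
  - by apply: measurableI => //; exact: (fin_measurable_pred (mem s)).
  - by apply/seteqP; split=> w // [[_ /= fx] [_ /=]]; rewrite fx (negbTE xs).
have := key (enum F) (enum_uniq _); rewrite big_enum /= => <-.
congr pr; apply/seteqP; split=> w => [Aw|[]//].
by split=> //=; rewrite mem_enum.
Qed.

Lemma same_lawP (F : finType) (f g : Omega -> F) :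
  fin_measurable f -> fin_measurable g ->
  (forall x, pr (f @^-1` [set x]) = pr (g @^-1` [set x])) -> same_law f g.
Proof.
move=> mf mg fg h.
rewrite (pr_fiber_sum mf (fin_measurable_pred h mf)).
rewrite (pr_fiber_sum mg (fin_measurable_pred h mg)).
apply: eq_bigr => x _.
have E (k : Omega -> F) : [set w | h (k w)] `&` k @^-1` [set x]
    = if h x then k @^-1` [set x] else set0.
  apply/seteqP; split=> w /=; first by move=> [hw <-]; rewrite hw.
  by case: ifP => // hx /= ->.
by rewrite !E; case: ifP.
Qed.

Lemma measurable_bool (c : bool) : measurable [set _ : Omega | c].
Proof.
case: c.
  by rewrite (_ : mkset _ = setT) //; apply/seteqP; split.
by rewrite (_ : mkset _ = set0) //; apply/seteqP; split.
Qed.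

(** A piece of measure [p x0] is cut off by Sierpinski's theorem and the rest is subdivided along
    [l]. The last value takes all that remains, which has the right measure because the [p x] sum to
    [pr A]. The list is nonempty so that [f] has a value everywhere. *)
Lemma subdivision (F : finType) (x0 : F) (l : seq F) (p : F -> R)
    (A : set Omega) :
  uniq (x0 :: l) -> measurable A -> (forall x, 0 <= p x) ->
  \sum_(x <- x0 :: l) p x = pr A ->
  exists f : Omega -> F, [/\ fin_measurable f, forall w, f w \in x0 :: l &
    forall x, x \in x0 :: l -> pr (A `&` f @^-1` [set x]) = p x].
Proof.
elim: l x0 A => [|x1 l IH] x0 A ul mA p0 sp.
  exists (fun=> x0); split=> [x|w|x].
  - rewrite (_ : _ @^-1` _ = [set w | x0 == x]).
      exact: measurable_bool.
    by apply/seteqP; split=> w /= /eqP.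
  - by rewrite inE.
  - rewrite inE => /eqP ->; rewrite big_seq1 in sp; rewrite sp.
    by congr pr; apply/seteqP; split=> w // [].
have [|B [mB BA pB]] := @atomless_sierpinski A (p x0) mA.
  by rewrite p0 -sp big_cons lerDl sumr_ge0.
have [||f [mf fl fP]] := IH x1 (A `\` B) _ (measurableD mA mB) p0.
- by case/andP: ul.
- by rewrite pr_setD // -sp pB [in RHS]big_cons addrC addKr.
exists (fun w => if w \in B then x0 else f w); split=> [x|w|x].
- rewrite (_ : _ @^-1` _ = (B `&` [set w | x0 == x]) `|` (f @^-1` [set x] `\` B)).
    apply: measurableU; last exact: measurableD.
    apply: measurableI => //.
    exact: measurable_bool.
  apply/seteqP; split=> w /=.
    case: ifPn => [|/negP]; rewrite inE => Bw; last by right.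
    by move=> ->; left; split=> //=.
  case=> [[Bw /eqP]|[fx Bw]]; first by rewrite ifT ?inE.
  by rewrite ifF //; apply/negP; rewrite inE.
- by case: ifP => _; rewrite inE ?eqxx ?fl ?orbT.
- have [->|xx0] := eqVneq x x0.
  move=> _; rewrite -pB; congr pr; apply/seteqP; split=> w /=.
    case=> Aw; case: ifPn => [|/negP]; rewrite inE // => Bw fw.
    by move: ul; rewrite cons_uniq -fw fl.
  by move=> Bw; split; [exact: BA|rewrite ifT ?inE].
rewrite inE (negbTE xx0) /= => xl; rewrite -fP //; congr pr.
apply/seteqP; split=> w /=.
  case=> Aw; case: ifPn => [|/negP]; rewrite inE // => Bw xw.
  by rewrite xw eqxx in xx0.
case=> -[Aw Bw] fx; split=> //; rewrite ifF //.
by apply/negP; rewrite inE.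
Qed.

Lemma fin_measurable_pair (F1 F2 : finType) (f : Omega -> F1) (g : Omega -> F2) :
  fin_measurable f -> fin_measurable g -> fin_measurable (fun w => (f w, g w)).
Proof.
move=> mf mg [x y].
rewrite (_ : _ @^-1` _ = f @^-1` [set x] `&` g @^-1` [set y]).
  exact: measurableI.
by apply/seteqP; split=> w /= [-> ->].
Qed.

(** The fibers of [f] and [f'] over [x] have equal measure. Each fiber of [f'] can therefore be
    subdivided in the measures that [g] induces on the corresponding fiber of [f]. *)
Lemma same_law_extension (F1 F2 : finType) (y0 : F2)
    (f f' : Omega -> F1) (g : Omega -> F2) :
  fin_measurable f -> fin_measurable f' -> fin_measurable g -> same_law f f' ->
  exists g' : Omega -> F2, fin_measurable g' /\
    same_law (fun w => (f w, g w)) (fun w => (f' w, g' w)).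
Proof.
move=> mf mf' mg ff'.
have /choice[h hP] : forall x, exists h : Omega -> F2, fin_measurable h /\
    forall y, pr (f' @^-1` [set x] `&` h @^-1` [set y])
      = pr (f @^-1` [set x] `&` g @^-1` [set y]).
  (* Moving [y0] to the front gives the enumeration of [F2] the nonempty form that [subdivision]
     expects. *)
  move=> x; have perm_y0 := perm_to_rem (mem_enum F2 y0).
  have [|||h [mh _ hP]] := @subdivision F2 y0 (rem y0 (enum F2))
      (fun y => pr (f @^-1` [set x] `&` g @^-1` [set y])) _ _ (mf' x).
  - by rewrite -(perm_uniq perm_y0) enum_uniq.
  - by move=> y; exact: pr_ge0.
  - rewrite -(perm_big _ perm_y0) /= big_enum -(pr_fiber_sum mg (mf x)).
    have E (k : Omega -> F1) : k @^-1` [set x] = [set w | pred1 x (k w)].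
      by apply/seteqP; split=> w /= /eqP.
    by rewrite !E; exact: ff'.
  - by exists h; split=> // y; rewrite hP // -(perm_mem perm_y0) mem_enum.
have fiber x y : f' @^-1` [set x] `&` (fun w => h (f' w) w) @^-1` [set y]
    = f' @^-1` [set x] `&` h x @^-1` [set y].
  by apply/seteqP; split=> w /= [->].
have mg' : fin_measurable (fun w => h (f' w) w).
  move=> y; rewrite (_ : _ @^-1` _ = \bigcup_(x in [set: F1])
    (f' @^-1` [set x] `&` h x @^-1` [set y])).
    apply: fin_bigcup_measurable => // x _; apply: measurableI => //.
    exact: (hP x).1.
  apply/seteqP; split=> w /=; first by exists (f' w).
  by case=> x _ [/= ->].
exists (fun w => h (f' w) w); split=> //.
apply: same_lawP; [exact: fin_measurable_pair|exact: fin_measurable_pair|].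
move=> [x y]; have E (k : Omega -> F1) (l : Omega -> F2) :
    (fun w => (k w, l w)) @^-1` [set (x, y)] = k @^-1` [set x] `&` l @^-1` [set y].
  by apply/seteqP; split=> w /= [-> ->].
by rewrite !E fiber (hP x).2.
Qed.

End Sierpinski.

(** * Types of tuples in a randomization *)

Section FiniteTypes.
Variable L : signature.

(** The tautology binds its own variable because the context may be empty. *)
Definition ftop n : formula L n := All (Eq (Var ord0) (Var ord0)).
Definition fbot n : formula L n := Neg (ftop n).

Definition bigconj n (s : seq (formula L n)) : formula L n :=
  foldr (@And L n) (ftop n) s.

Definition bigdisj n (s : seq (formula L n)) : formula L n :=
  foldr (@Or L n) (fbot n) s.

Definition pattern n (I : finType) (Theta : I -> formula L n)
    (S : {ffun I -> bool}) : formula L n :=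
  bigconj [seq if S i then Theta i else Neg (Theta i) | i <- enum I].

Variable M : structure L.

Lemma sat_bigconj n (I : eqType) (F : I -> formula L n) (s : seq I)
    (e : 'I_n -> M) :
  sat (bigconj (map F s)) e <-> forall i, i \in s -> sat (F i) e.
Proof.
elim: s => [|i s IH] /=; first by split.
rewrite IH; split=> [[h hs] j|h].
  by rewrite inE => /orP[/eqP ->|/hs].
by split=> [|j js]; apply: h; rewrite inE ?eqxx ?js ?orbT.
Qed.

Lemma sat_bigdisj n (I : eqType) (F : I -> formula L n) (s : seq I)
    (e : 'I_n -> M) :
  sat (bigdisj (map F s)) e <-> exists2 i, i \in s & sat (F i) e.
Proof.
elim: s => [|i s IH] /=; first by split=> [h|[]//]; exfalso; exact: h.
rewrite IH; split=> [[h|[j js h]]|[j]].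
- by exists i => //; rewrite inE eqxx.
- by exists j => //; rewrite inE js orbT.
- by rewrite inE => /orP[/eqP ->|js h]; [left|right; exists j].
Qed.

Lemma sat_pattern n (I : finType) (Theta : I -> formula L n) S (e : 'I_n -> M) :
  sat (pattern Theta S) e <-> S = [ffun i => `[<sat (Theta i) e>]].
Proof.
rewrite /pattern sat_bigconj; split=> [h|-> i _].
  apply/ffunP => i; rewrite ffunE; have := h i (mem_enum _ _).
  by case: (S i) => hi; apply/esym; [apply/asboolP|apply/asboolP].
by rewrite ffunE; case: asboolP.
Qed.

Definition ftype n b (I : finType) (Theta : I -> formula L n) (v : 'I_n -> M)
    (B : 'I_b -> Prop) : {ffun I + 'I_b -> bool} :=
  [ffun s => match s with
             | inl i => `[<sat (Theta i) v>]
             | inr j => `[<B j>]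
             end].

End FiniteTypes.

(** * Choosing and gluing random elements *)

Section RandomizationTools.
Variables (R : realType) (L : signature) (M : structure L) (K : randomization R M).
Local Notation RK := (sortK (rnd_interp K)).
Local Notation RB := (sortB (rnd_interp K)).
Local Notation Omega := (rnd_Omega K).

Lemma truth_setE n (phi : formula L n) (e : 'I_n -> RK) :
  measurable [set w | sat phi (fun i => sval (e i) w)].
Proof. exact: (rnd_measurable phi (fun i => svalP (e i))). Qed.

Lemma witness n (theta : formula L n.+1) (e : 'I_n -> RK) :
  exists x : RK, forall w,
    (exists m, sat theta (scons m (fun i => sval (e i) w))) ->
    sat theta (scons (sval x w) (fun i => sval (e i) w)).
Proof.
have [a Ka] := rnd_witness theta (fun i => svalP (e i)).
move=> /seteqP[_ h]; exists (exist _ a Ka) => w /h.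
by rewrite /truth_set /= (scons_map (fun g => g w)).
Qed.

(** Since [D] is the event of some [psi(a)], the formula saying that [z] is [x] where [psi(a)] holds
    and [y] elsewhere is first-order. It is solvable at every sample point, so the witness clause
    provides [z]. *)
Lemma glue2 (x y : RK) (D : set Omega) : measurable D ->
  exists z : RK, forall w,
    (D w -> sval z w = sval x w) /\ (~ D w -> sval z w = sval y w).
Proof.
move=> mD; have [n [psi [a [Ka DE]]]] := rnd_exhaustive mD.
pose up (i : 'I_n) : 'I_n.+3 := lift ord0 (lift ord0 (lift ord0 i)).
pose vx : 'I_n.+3 := lift ord0 ord0.
pose vy : 'I_n.+3 := lift ord0 (lift ord0 ord0).
pose theta : formula L n.+3 :=
  Or (And (fren psi up) (Eq (Var ord0) (Var vx)))
     (And (Neg (fren psi up)) (Eq (Var ord0) (Var vy))).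
have [z hz] := witness theta
  (scons x (scons y (fun i => exist _ (a i) (Ka i)))).
exists z => w; have := hz w.
rewrite !(scons_map (fun g : RK => sval g w)) /=.
set e := scons _ (fun i => a i w).
have satup m : sat (fren psi up) (scons m (scons (sval x w) e)) <-> D w.
  rewrite sat_fren (_ : comp_env up _ = (fun i => a i w)) ?DE //.
  by apply/funext => i; rewrite /comp_env /up !sconsS /e sconsS.
rewrite satup scons0 /vx /vy !sconsS !scons0 /e scons0 => -[|[Dw ->]|[nDw ->]].
- have [Dw|nDw] := pselect (D w).
    by exists (sval x w); left; rewrite satup !sconsS !scons0.
  by exists (sval y w); right; rewrite satup !sconsS !scons0.
- by split.
- by split.
Qed.

Lemma glue (F : finType) (f : Omega -> F) (y : F -> RK) :
  fin_measurable f -> exists z : RK, forall w, sval z w = sval (y (f w)) w.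
Proof.
move=> mf.
have key (s : seq F) : exists z : RK, forall w, f w \in s ->
    sval z w = sval (y (f w)) w.
  elim: s => [|x s [z IH]].
    by case: (rnd_bounded K) => -[z] _ _ _; exists z.
  have [z' hz'] := glue2 (y x) z (mf x).
  exists z' => w; rewrite inE; have [fx _|fx /= fs] := eqVneq (f w) x.
    by rewrite (hz' w).1 // fx.
  by rewrite (hz' w).2 ?IH //= => /eqP; rewrite (negbTE fx).
have [z hz] := key (enum F); exists z => w; apply: hz; exact: mem_enum.
Qed.

Section RandomType.
Variables (n b : nat) (I : finType) (Theta : I -> formula L n).
Implicit Types (eK : 'I_n -> RK) (eB : 'I_b -> RB).

Definition rtype eK eB (w : Omega) : {ffun I + 'I_b -> bool} :=
  ftype Theta (fun i => sval (eK i) w) (fun j => sval (eB j) w).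

Lemma rtype_measurable eK eB : fin_measurable (rtype eK eB).
Proof.
move=> t; rewrite (_ : _ @^-1` _
  = \bigcap_(s in [set: I + 'I_b]) [set w | rtype eK eB w s = t s]).
  apply: fin_bigcap_measurable => // -[i|j] _.
    rewrite (_ : [set w | _] = if t (inl i)
        then [set w | sat (Theta i) (fun i => sval (eK i) w)]
        else ~` [set w | sat (Theta i) (fun i => sval (eK i) w)]).
      by case: (t _); [|apply: measurableC]; exact: truth_setE.
    by apply/seteqP; split=> w /=; rewrite ffunE; case: (t _); case: asboolP.
  rewrite (_ : [set w | _] = if t (inr j) then sval (eB j) else ~` sval (eB j)).
    by case: (t _); [|apply: measurableC]; exact: svalP.
  by apply/seteqP; split=> w /=; rewrite ffunE; case: (t _); case: asboolP.
apply/seteqP; split=> w /= h; first by move=> s _ /=; rewrite h.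
by apply/ffunP => s; exact: h.
Qed.

End RandomType.

End RandomizationTools.

(** * Quantifier elimination in distribution *)

Section Determinacy.
Variables (R : realType) (L : signature).

Lemma pr_ae_eq d (Omega : measurableType d) (P : probability Omega R)
    (A B G : set Omega) : measurable A -> measurable B -> measurable G ->
  pr P (~` G) = 0 -> (forall w, G w -> A w <-> B w) -> pr P A = pr P B.
Proof.
move=> mA mB mG G0 AB.
have null (C : set Omega) : measurable C -> pr P (C `\` G) = 0.
  move=> mC; apply/le_anti; rewrite pr_ge0 -G0 andbT.
  by apply: le_pr => [||w []//]; [exact: measurableD|exact: measurableC].
rewrite (prID P mA mG) (prID P mB mG) !null // !addr0; congr pr.
by apply/seteqP; split=> w [] /[swap] Gw /(AB w Gw).
Qed.

Definition restrict_ftype b (I J : finType) (f : I -> J)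
    (t : {ffun J + 'I_b -> bool}) : {ffun I + 'I_b -> bool} :=
  [ffun s => match s with inl i => t (inl (f i)) | inr j => t (inr j) end].

Lemma ftype_restrict n b (I J : finType) (f : I -> J)
    (Theta : J -> formula L n) (M : structure L) (v : 'I_n -> M)
    (B : 'I_b -> Prop) :
  ftype (Theta \o f) v B = restrict_ftype f (ftype Theta v B).
Proof. by apply/ffunP => -[i|j]; rewrite !ffunE. Qed.

Definition sum_family n (I J : finType) (Theta : I -> formula L n)
    (Upsilon : J -> formula L n) (s : I + J) : formula L n :=
  match s with inl i => Theta i | inr j => Upsilon j end.

Lemma eterm_decided k b (t : eterm L k b) :
  exists (I : finType) (Theta : I -> formula L k)
    (h : pred {ffun I + 'I_b -> bool}),
    forall (M : structure L) (v : 'I_k -> M) (B : 'I_b -> Prop),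
      holds_at v B t <-> h (ftype Theta v B).
Proof.
elim: t => [j|n phi x|||t1 [I1 [Th1 [h1 H1]]] t2 [I2 [Th2 [h2 H2]]]
  |t1 [I1 [Th1 [h1 H1]]] t2 [I2 [Th2 [h2 H2]]]|t [I [Th [h H]]]] /=.
- exists void, (fun _ => ftop L k), (fun t => t (inr j)) => M v B.
  by rewrite ffunE; split=> /asboolP.
- exists unit, (fun _ => fren phi x), (fun t => t (inl tt)) => M v B.
  by rewrite ffunE asboolE sat_fren.
- by exists void, (fun _ => ftop L k), xpredT.
- by exists void, (fun _ => ftop L k), xpred0.
- exists (I1 + I2)%type, (sum_family Th1 Th2),
    (fun t => h1 (restrict_ftype inl t) && h2 (restrict_ftype inr t)) => M v B.
  rewrite -!ftype_restrict H1 H2; split; first by case=> -> ->.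
  by case/andP.
- exists (I1 + I2)%type, (sum_family Th1 Th2),
    (fun t => h1 (restrict_ftype inl t) || h2 (restrict_ftype inr t)) => M v B.
  rewrite -!ftype_restrict H1 H2; split; first by case=> ->; rewrite ?orbT.
  by case/orP; [left|right].
- exists I, Th, (fun t => ~~ h t) => M v B; rewrite H.
  by split=> /negP.
Qed.

(** [Theta] is uniform over all structures and randomizations. The two tuples compared live in the
    same randomization. *)
Definition determined k b (Phi : cformula R L k b) (I : finType)
    (Theta : I -> formula L k) : Prop :=
  forall (M : structure L) (K : randomization R M)
    (eK eK' : 'I_k -> sortK (rnd_interp K))
    (eB eB' : 'I_b -> sortB (rnd_interp K)),
    same_law (rnd_prob K) (rtype Theta eK eB) (rtype Theta eK' eB') ->
    value Phi eK eB = value Phi eK' eB'.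

Lemma determined_mono k b (Phi : cformula R L k b) (I J : finType) (f : I -> J)
    (Theta : J -> formula L k) :
  determined Phi (Theta \o f) -> determined Phi Theta.
Proof.
move=> h M K eK eK' eB eB' law; apply: h => p.
have E (e : 'I_k -> sortK (rnd_interp K)) (B : 'I_b -> sortB (rnd_interp K)) :
    [set w | p (rtype (Theta \o f) e B w)]
    = [set w | p (restrict_ftype f (rtype Theta e B w))].
  by apply/funext => w; rewrite /rtype /mkset ftype_restrict.
rewrite !E; exact: (law (p \o restrict_ftype f)).
Qed.

Lemma determined_mu k b (t : eterm L k b) :
  exists (I : finType) (Theta : I -> formula L k),
    determined (CMu R t) Theta.
Proof.
have [I [ Theta [h H]]] := eterm_decided t; exists I, Theta.
move=> M K eK eK' eB eB' law; rewrite /= /rnd_mu -2!/(pr _ _).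
have E e B : sval (eeval (N := rnd_interp K) e B t) = [set w | h (rtype Theta e B w)].
  by apply/funext => w; rewrite rnd_eevalE; apply/propext; exact: H.
by rewrite !E; exact: law.
Qed.

(** The formulas [Ex (pattern Theta S)] record which patterns are realizable over the parameters.
    The pattern function [g] of [x] over [eK] is copied to a function [g'] over [eK'] by extension
    of laws, and [x'] is glued from witnesses of the patterns that [g'] prescribes. *)
Lemma determined_extendK n b (I : finType) (Theta : I -> formula L n.+1)
    (M : structure L) (K : randomization R M)
    (eK eK' : 'I_n -> sortK (rnd_interp K))
    (eB eB' : 'I_b -> sortB (rnd_interp K)) :
  same_law (rnd_prob K) (rtype (fun S => Ex (pattern Theta S)) eK eB)
    (rtype (fun S => Ex (pattern Theta S)) eK' eB') ->
  forall x, exists x', same_law (rnd_prob K)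
    (rtype Theta (scons x eK) eB) (rtype Theta (scons x' eK') eB').
Proof.
set f := rtype _ eK eB; set f' := rtype _ eK' eB' => law x.
pose tyI (t : {ffun I + 'I_b -> bool}) : {ffun I -> bool} :=
  [ffun i => t (inl i)].
pose g w := tyI (rtype Theta (scons x eK) eB w).
have mg : fin_measurable g.
  move=> S; rewrite (_ : _ @^-1` _
      = [set w | (fun t => tyI t == S) (rtype Theta (scons x eK) eB w)]).
    apply: (fin_measurable_pred (fun t => tyI t == S)); exact: rtype_measurable.
  by apply/seteqP; split=> w /= /eqP.
have mf : fin_measurable f by exact: rtype_measurable.
have mf' : fin_measurable f' by exact: rtype_measurable.
have [g' [mg' law']] := same_law_extension (@rnd_atomless _ _ _ K)
  [ffun => false] mf mf' mg law.
have /choice[y yP] := fun S => witness (pattern Theta S) eK'.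
have [x' hx'] := glue y mg'.
exists x' => h.
(* The type of the extended tuple is recovered from the pair: the pattern from the second component,
   the event variables from the first. *)
pose comb (t : {ffun {ffun I -> bool} + 'I_b -> bool} * {ffun I -> bool}) :
    {ffun I + 'I_b -> bool} :=
  [ffun s => match s with inl i => t.2 i | inr j => t.1 (inr j) end].
have -> : [set w | h (rtype Theta (scons x eK) eB w)]
    = [set w | h (comb (f w, g w))].
  apply/funext => w; rewrite /mkset; congr (is_true (h _)).
  by apply/ffunP => -[i|j]; rewrite !ffunE.
rewrite (law' (h \o comb)); apply/esym.
(* [ok] says that the prescribed pattern is realizable. It holds everywhere for [(f, g)], so by
   equality of laws almost everywhere for [(f', g')], and on that set [x'] does realize it. *)
pose ok (t : {ffun {ffun I -> bool} + 'I_b -> bool} * {ffun I -> bool}) :=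
  t.1 (inl t.2).
pose G := [set w | ok (f' w, g' w)].
have mfg' := fin_measurable_pair mf' mg'.
apply: (@pr_ae_eq _ _ _ _ _ G).
- apply: fin_measurable_pred; exact: rtype_measurable.
- exact: (fin_measurable_pred (h \o comb) mfg').
- exact: (fin_measurable_pred ok mfg').
- rewrite (_ : ~` G = [set w | (predC ok) (f' w, g' w)]).
    rewrite -(law' (predC ok)).
    rewrite (_ : mkset _ = set0) ?/pr ?measure0 //.
    apply/seteqP; split=> w //= /negP; apply; rewrite /ok ffunE; apply/asboolP => /=.
    exists (sval x w); apply/sat_pattern; apply/ffunP => i; rewrite !ffunE.
    by rewrite (scons_map (fun z => sval z w)).
  by apply/seteqP; split=> w /= /negP.
- move=> w; rewrite /G /ok /= ffunE => /asboolP /= Gw.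
  have := yP (g' w) w Gw => /sat_pattern g'E.
  suff -> : rtype Theta (scons x' eK') eB' w = comb (f' w, g' w) by [].
  apply/ffunP => -[i|j]; rewrite !ffunE //= g'E ffunE.
  by rewrite (scons_map (fun z => sval z w)) hx'.
Qed.

(** The indicator of [X] is copied by extension of laws, and [X'] is the set where the copy is true.
    No new formulas are needed, since the types already include membership in the event
    variables. *)
Lemma determined_extendB n b (I : finType) (Theta : I -> formula L n)
    (M : structure L) (K : randomization R M)
    (eK eK' : 'I_n -> sortK (rnd_interp K))
    (eB eB' : 'I_b -> sortB (rnd_interp K)) :
  same_law (rnd_prob K) (rtype Theta eK eB) (rtype Theta eK' eB') ->
  forall X, exists X', same_law (rnd_prob K)
    (rtype Theta eK (scons X eB)) (rtype Theta eK' (scons X' eB')).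
Proof.
set f := rtype _ eK eB; set f' := rtype _ eK' eB' => law X.
pose g w := `[<sval X w>].
have mg : fin_measurable g.
  move=> c; rewrite (_ : _ @^-1` _ = if c then sval X else ~` sval X).
    by case: c; [|apply: measurableC]; exact: svalP.
  by apply/seteqP; split=> w /=; rewrite /g; case: c; case: asboolP.
have mf : fin_measurable f by exact: rtype_measurable.
have mf' : fin_measurable f' by exact: rtype_measurable.
have [g' [mg' law']] := same_law_extension (@rnd_atomless _ _ _ K)
  true mf mf' mg law.
exists (exist _ _ (mg' true)) => h.
pose comb (t : {ffun I + 'I_b -> bool} * bool) : {ffun I + 'I_b.+1 -> bool} :=
  [ffun s => match s with
             | inl i => t.1 (inl i)
             | inr j => scons t.2 (fun j => t.1 (inr j)) j
             end].
have E e B Y w : rtype Theta e (scons Y B) w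
    = comb (rtype Theta e B w, `[<sval Y w>]).
  apply/ffunP => -[i|j]; rewrite !ffunE //=.
  case: (unliftP ord0 j) => [j' ->|->]; first by rewrite !sconsS ffunE.
  by rewrite !scons0.
rewrite (_ : [set w | _] = [set w | (h \o comb) (f w, g w)]); last first.
  by apply/funext => w; rewrite /mkset E.
rewrite law'; congr pr; apply/funext => w; rewrite /mkset E /=.
congr (is_true (h (comb (_, _)))); apply/esym.
by rewrite /preimage /=; case: (g' w); apply/asboolP.
Qed.

Lemma same_law_sym d (Omega : measurableType d) (P : probability Omega R)
    (F : finType) (f g : Omega -> F) : same_law P f g -> same_law P g f.
Proof. by move=> h p. Qed.

(** Under a quantifier, each [x] on one side has a counterpart on the other with the same value. The
    two ranges, and so their suprema and infima, coincide. *)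
Theorem value_determined k b (Phi : cformula R L k b) :
  exists (I : finType) (Theta : I -> formula L k), determined Phi Theta.
Proof.
elim: Phi => {k b} [k b t|k b t1 t2|k b x y|k b n u Phi IH
  |k b Phi [I [ Theta H]]|k b Phi [I [ Theta H]]
  |k b Phi [I [ Theta H]]|k b Phi [I [ Theta H]]].
- exact: determined_mu.
(* [distB] is the measure of the symmetric difference, written here as an event term. *)
- have [I [ Theta H]] := determined_mu
    (EJoin (EMeet t1 (ECompl t2)) (EMeet t2 (ECompl t1))).
  by exists I, Theta.
- have [I [ Theta H]] := determined_mu
    (EEvent b (Neg (Eq (Var ord0) (Var ord_max)) : formula L 2)
      (fun i => if i == ord0 then x else y)).
  exists I, Theta => M K eK eK' eB eB' /H /=.
  have E (e : 'I_k -> sortK (rnd_interp K)) :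
      (fun i : 'I_2 => e (if i == ord0 then x else y))
      = (fun i => if i == ord0 then e x else e y).
    by apply/funext => i; case: ifP.
  by rewrite !E.
- have /choice[F H] : forall i, exists F : {I : finType & I -> formula L k},
      determined (Phi i) (projT2 F).
    by move=> i; have [I [ Theta H]] := IH i; exists (existT _ I Theta).
  exists {i : 'I_n & projT1 (F i)}, (fun p => projT2 (F (tag p)) (tagged p)).
  move=> M K eK eK' eB eB' law /=; congr (conn_fun u _); apply/rowP => i.
  rewrite !mxE; move: law.
  apply: (determined_mono (f := fun s => Tagged (fun i => projT1 (F i)) s)).
  exact: H.
- exists {ffun I -> bool}, (fun S => Ex (pattern Theta S)).
  move=> M K eK eK' eB eB' law /=; congr sup; apply/seteqP; split=> _ [x _ <-].
    have [x' /H ->] := determined_extendK law x; by exists x'.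
  have [x' /H ->] := determined_extendK (same_law_sym law) x; by exists x'.
- exists {ffun I -> bool}, (fun S => Ex (pattern Theta S)).
  move=> M K eK eK' eB eB' law /=; congr inf; apply/seteqP; split=> _ [x _ <-].
    have [x' /H ->] := determined_extendK law x; by exists x'.
  have [x' /H ->] := determined_extendK (same_law_sym law) x; by exists x'.
- exists I, Theta.
  move=> M K eK eK' eB eB' law /=; congr sup; apply/seteqP; split=> _ [x _ <-].
    have [x' /H ->] := determined_extendB law x; by exists x'.
  have [x' /H ->] := determined_extendB (same_law_sym law) x; by exists x'.
- exists I, Theta.
  move=> M K eK eK' eB eB' law /=; congr inf; apply/seteqP; split=> _ [x _ <-].
    have [x' /H ->] := determined_extendB law x; by exists x'.
  have [x' /H ->] := determined_extendB (same_law_sym law) x; by exists x'.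
Qed.

End Determinacy.

(** * Isolated patterns *)

Section Isolation.
Variables (L : signature) (n : nat) (I : finType) (Theta : I -> formula L n.+1).
Implicit Type Q : {ffun I -> bool}.

(** In a context [(u', u, v)] this renaming selects [(u', v)], whereas [lift ord0] selects
    [(u, v)]. *)
Definition skip1 m (i : 'I_m.+1) : 'I_m.+2 :=
  scons ord0 (fun j => lift ord0 (lift ord0 j)) i.

Lemma comp_env_skip1 (X : Type) m (x y : X) (e : 'I_m -> X) :
  comp_env (@skip1 m) (scons x (scons y e)) = scons x e.
Proof.
apply/funext => i; rewrite /comp_env /skip1.
by case: (unliftP ord0 i) => [j|] ->; rewrite ?sconsS ?scons0 // !sconsS.
Qed.

Lemma comp_env_lift0 (X : Type) m (x : X) (e : 'I_m -> X) :
  comp_env (lift ord0) (scons x e) = e.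
Proof. by apply/funext => i; rewrite /comp_env sconsS. Qed.

(* Variable 0 differs from variable 1 but has the same pattern. *)
Definition other Q : formula L n.+2 :=
  And (fren (pattern Theta Q) (@skip1 n))
      (Neg (Eq (Var ord0) (Var (lift ord0 ord0)))).

(** Uniqueness is written into the formula, so that it is functional over every theory. *)
Definition isolating Q : formula L n.+1 :=
  And (pattern Theta Q) (Neg (Ex (other Q))).

Definition isolated : formula L n.+1 :=
  bigdisj [seq isolating Q | Q <- enum {ffun I -> bool}].

Lemma sat_other (M : structure L) Q (u u' : M) (v : 'I_n -> M) :
  sat (other Q) (scons u' (scons u v)) <->
  sat (pattern Theta Q) (scons u' v) /\ u' <> u.
Proof. by rewrite /= sat_fren comp_env_skip1 sconsS !scons0. Qed.

Lemma sat_isolating (M : structure L) Q (u : M) (v : 'I_n -> M) :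
  sat (isolating Q) (scons u v) <-> sat (pattern Theta Q) (scons u v) /\
  forall u', sat (pattern Theta Q) (scons u' v) -> u' = u.
Proof.
split=> -[pu h]; split=> //.
  move=> u' pu'; apply: contrapT => uu'; apply: h.
  by exists u'; apply/sat_other.
by case=> u' /sat_other[/h].
Qed.

Lemma isolating_functional (T : theory L) Q : functional T (isolating Q).
Proof.
by move=> M _ v u u' /sat_isolating[pu _] /sat_isolating[_]; exact.
Qed.

Lemma sat_isolated (M : structure L) (u : M) (v : 'I_n -> M) :
  sat isolated (scons u v) <-> exists Q, sat (isolating Q) (scons u v).
Proof.
rewrite sat_bigdisj; split=> [[Q _ h]|[Q h]]; exists Q => //.
by rewrite mem_enum.
Qed.

Variables (R : realType) (M : structure L) (K : randomization R M).
Local Notation RK := (sortK (rnd_interp K)).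

(** The choice depends only on the pattern at the sample point, which takes finitely many values.
    Witnesses of [other Q], one for each [Q], can therefore be glued. *)
Lemma move_off_isolated (x : RK) (e : 'I_n -> RK) :
  exists x' : RK, (forall w (eB : 'I_0 -> sortB (rnd_interp K)),
      rtype Theta (scons x' e) eB w = rtype Theta (scons x e) eB w) /\
    forall w, sval x' w = sval x w ->
      sat isolated (scons (sval x w) (fun i => sval (e i) w)).
Proof.
pose v w i := sval (e i) w; pose xv w := scons (sval x w) (v w).
pose ty w : {ffun I -> bool} := [ffun i => `[<sat (Theta i) (xv w)>]].
(* [None] marks the sample points where [x] is alone in its pattern; there [x'] keeps the value of
   [x]. *)
pose f w := if `[<sat (Ex (other (ty w))) (xv w)>] then Some (ty w) else None.
have patty w : sat (pattern Theta (ty w)) (xv w) by apply/sat_pattern.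
have xvE w : (fun i => sval (scons x e i) w) = xv w.
  by rewrite (scons_map (fun z : RK => sval z w)).
have fNone w : f w = None <-> sat isolated (xv w).
  rewrite sat_isolated /f; case: asboolP => h; split=> //.
    by case=> Q [/sat_pattern Qty]; rewrite (Qty : Q = ty w) => -[].
  by move=> _; exists (ty w).
have mf : fin_measurable f.
  case=> [Q|].
    rewrite (_ : _ @^-1` _ = [set w | sat (And (pattern Theta Q) (Ex (other Q)))
        (fun i => sval (scons x e i) w)]); first exact: truth_setE.
    apply/seteqP; split=> w; rewrite /preimage /mkset xvE /f.
      by case: asboolP => // h [<-]; split.
    by case=> /sat_pattern -> h; case: asboolP.
  rewrite (_ : _ @^-1` _ = [set w | sat isolated
      (fun i => sval (scons x e i) w)]); first exact: truth_setE.
  by apply/seteqP; split=> w; rewrite /preimage /mkset xvE => /fNone.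
have /choice[c cP] := fun Q => witness (other Q) (scons x e).
have [x' hx'] := glue (fun o => if o is Some Q then c Q else x) mf.
exists x'; split=> [w eB|w].
  apply/ffunP => -[i|j]; rewrite !ffunE //.
  rewrite !(scons_map (fun z : RK => sval z w)) -/(v w) -/(xv w) hx'.
  rewrite /f; case: (asboolP (sat (Ex (other (ty w))) _)) => // h.
  have := cP (ty w) w; rewrite xvE => /(_ h) /sat_other[/sat_pattern tyE _].
  by move/ffunP/(_ i): tyE; rewrite !ffunE.
rewrite hx' /f; case: (asboolP (sat (Ex _) _)) => [h|h _]; last first.
  by apply/fNone; rewrite /f; case: asboolP.
by have := cP (ty w) w; rewrite xvE => /(_ h) /sat_other[_].
Qed.

End Isolation.

(** * Measure and isolated patterns in a model of T^R *)

Section ModelFacts.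
Variables (R : realType) (L : signature) (T : theory L) (N : interpretation R L).
Hypothesis N_model : rnd_model T N.

Let bN : bounded_interp N := pre_structure_bounded (ms_pre N_model.1).

Lemma mu_ge0 (E : sortB N) : 0 <= mu E.
Proof. by case: bN => _ h _ _; case/andP: (h E). Qed.

Lemma mu_top : mu (etop N) = 1.
Proof.
(* The constant 1 enters continuous formulas as a connective of arity 0. *)
have cst1_range (v : 'rV[R]_0) : cube v -> 0 <= (1 : R) <= 1.
  by rewrite ler01 lexx.
have cst1_continuous : {within @cube R 0, continuous (fun=> (1 : R))}.
  by apply: continuous_subspaceT => v; exact: cst_continuous.
pose Phi : cformula R L 0 0 := cdiff
  (CConn (Connective cst1_range cst1_continuous) (fun _ => CMu R (ETop L 0 0)))
  (CMu R (ETop L 0 0)).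
have Phi0 (M : structure L) : models M T -> forall (K : randomization R M) eK eB,
    value (N := rnd_interp K) Phi eK eB = 0.
  move=> TM K eK eB; rewrite value_cdiff; last exact: rnd_bounded.
  by rewrite /= /rnd_mu /= probability_setT /= subrr normr0.
have := transfer N_model Phi0 (@noenv _) (@noenv _).
by rewrite value_cdiff //= => /eqP; rewrite normr_eq0 subr_eq0 => /eqP <-.
Qed.

Let X0 {k} : eterm L k 2 := EVar L k ord0.
Let X1 {k} : eterm L k 2 := EVar L k (lift ord0 ord0).
Let env2 (E F : sortB N) : 'I_2 -> sortB N := scons E (fun=> F).

Lemma mu_compl (E : sortB N) : mu (ecompl E) = 1 - mu E.
Proof.
have := @mu_additive _ _ _ _ N_model 0 2 (ETop L 0 2) X0 (ECompl X0)
  (@noenv _) (env2 E E).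
rewrite /= /env2 scons0 mu_top => ->; first by rewrite addrC addKr.
by move=> M _ v B /=; have [|] := pselect (B ord0); tauto.
Qed.

Lemma mu_split (E F : sortB N) : mu E = mu (emeet E F) + mu (emeet E (ecompl F)).
Proof.
have := @mu_additive _ _ _ _ N_model 0 2 X0 (EMeet X0 X1) (EMeet X0 (ECompl X1))
  (@noenv _) (env2 E F).
rewrite /= /env2 scons0 sconsS; apply => M _ v B /=.
by have [|] := pselect (B (lift ord0 ord0)); tauto.
Qed.

Lemma emeetC (E F : sortB N) : emeet E F = emeet F E.
Proof.
have := @eeval_eq _ _ _ _ N_model 0 2 (EMeet X0 X1) (EMeet X1 X0)
  (@noenv _) (env2 E F).
by rewrite /= /env2 scons0 sconsS; apply => M _ v B /=; tauto.
Qed.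

Lemma mu_meet_le (E F : sortB N) : mu (emeet E F) <= mu E.
Proof. by rewrite (mu_split E F) lerDl mu_ge0. Qed.

Definition neq2 : formula L 2 := Neg (Eq (Var ord0) (Var (lift ord0 ord0))).

Lemma distKE (x y : sortK N) :
  distK x y = mu (event neq2 (scons x (fun=> y))).
Proof.
pose Phi : cformula R L 2 0 :=
  cdiff (CDistK R L 0 ord0 (lift ord0 ord0)) (CMu R (EEvent 0 neq2 id)).
have Phi0 (M : structure L) : models M T -> forall (K : randomization R M) eK eB,
    value (N := rnd_interp K) Phi eK eB = 0.
  move=> TM K eK eB; rewrite value_cdiff; last exact: rnd_bounded.
  apply/eqP; rewrite normr_eq0 subr_eq0; apply/eqP => /=.
  by congr (fine (rnd_prob K _)); apply/funext => w.
have := transfer N_model Phi0 (scons x (fun=> y)) (@noenv _).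
rewrite value_cdiff //= scons0 sconsS => /eqP.
by rewrite normr_eq0 subr_eq0 => /eqP.
Qed.

(** In a randomization, [move_off_isolated] makes the sum equal to 0. The condition that its infimum
    over [x'] is 0 transfers to [N], where the infimum need only be approached. *)
Lemma approx_move n (Phi : cformula R L n.+1 0) (I : finType)
    (Theta : I -> formula L n.+1) (x : sortK N) (e : 'I_n -> sortK N) (eps : R) :
  determined Phi Theta -> 0 < eps -> exists x' : sortK N,
    `|value Phi (scons x' e) (@noenv _) - value Phi (scons x e) (@noenv _)|
    + mu (emeet (ecompl (event neq2 (scons x' (fun=> x))))
                (ecompl (event (isolated Theta) (scons x e)))) < eps.
Proof.
move=> det eps0.
pose eq01 (i : 'I_2) : 'I_n.+2 := scons ord0 (fun=> lift ord0 ord0) i.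
(* The event that [x'] agrees with [x] although [x] is not isolated there. *)
pose stay : eterm L n.+2 0 := EMeet (ECompl (EEvent 0 neq2 eq01))
  (ECompl (EEvent 0 (isolated Theta) (lift ord0))).
pose Psi : cformula R L n.+2 0 :=
  cadd (cdiff (cren Phi (@skip1 n) id) (cren Phi (lift ord0) id)) (CMu R stay).
have PsiE (N' : interpretation R L) (y z : sortK N') u eB : bounded_interp N' ->
    value Psi (scons y (scons z u)) eB = Num.min 1
      (`|value Phi (scons y u) eB - value Phi (scons z u) eB|
       + mu (eeval (scons y (scons z u)) eB stay)).
  move=> bN'; rewrite value_cadd // value_cdiff // !value_cren.
  by rewrite comp_env_skip1 comp_env_lift0.
have stayE (N' : interpretation R L) (y z : sortK N') u eB :
    eeval (scons y (scons z u)) eB stay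
    = emeet (ecompl (event neq2 (scons y (fun=> z))))
            (ecompl (event (isolated Theta) (scons z u))).
  rewrite /=; congr emeet; congr ecompl; congr event.
    by apply/funext => i; rewrite /eq01; case: (unliftP ord0 i) => [j|] ->;
      rewrite ?sconsS ?scons0.
  exact: comp_env_lift0.
have : value (CInfK Psi) (scons x e) (@noenv _) = 0.
  apply: (transfer N_model) => M TM K eK eB; have bK := rnd_bounded K.
  rewrite (scons_eta eK); move: (eK ord0) (fun i => _) => {}z u.
  change (inf (range (fun y => value Psi (scons y (scons z u)) eB)) = 0).
  apply/inf_range_eq0 => [|y|d d0]; [by case: bK|exact: (value01 Psi _ _ bK)|].
  have [z' [tyE offE]] := move_off_isolated Theta z u.
  exists z'. rewrite PsiE //; apply: le_lt_trans d0; rewrite ge_min; apply/orP.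
  right; rewrite (det M K (scons z' u) (scons z u) eB eB); last first.
    by move=> h; congr pr; apply/funext => w; rewrite /mkset tyE.
  rewrite subrr normr0 add0r stayE /= /rnd_mu /=.
  rewrite (_ : _ `&` _ = set0) ?measure0 //.
  apply/seteqP; split=> w // [/contrapT Eq Niso]; apply: Niso.
  have {Eq} : sval z' w = sval z w.
    by move: Eq; rewrite /truth_set /= scons0 sconsS.
  move/offE; rewrite /truth_set /=.
  by rewrite (scons_map (fun y : sortK (rnd_interp K) => sval y w)).
have hK : inhabited (sortK N) by case: bN.
rewrite -[LHS]/(inf (range (fun y => value Psi (scons y (scons x e)) (@noenv _)))).
move/(inf_range_eq0 hK) => /(_ (fun y => value01 _ _ _ bN)) H.
(* A bound below 1 ensures that the truncation in [Psi] is inactive. *)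
have [|x'] := H (Num.min 1 eps); first by rewrite lt_min ltr01.
rewrite PsiE // stayE lt_min => /andP[h1 h2]; exists x'.
by move: h1 h2; rewrite !gt_min !ltxx /= => h1; case/orP => //; exact: lt_trans.
Qed.

(** With [x'] from [approx_move], the complement of [iso] splits into a part where [x' = b], which
    is small by the choice of [x'], and a part where [x'] differs from [b]. The latter has measure
    at most [distK x' b], which is of order [eps] because [Phi] takes nearly the same value at [x']
    and at [b]. *)
Lemma isolated_large n (Phi : cformula R L n.+1 0) (I : finType)
    (Theta : I -> formula L n.+1) (b : sortK N) (e : 'I_n -> sortK N) (eps : R) :
  determined Phi Theta -> 0 < eps ->
  (forall x, `|value Phi (scons x e) (@noenv _) - distK x b| <= eps) ->
  1 - mu (event (isolated Theta) (scons b e)) <= 4 * eps.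
Proof.
move=> det eps0 near.
have [x'] := approx_move b e det eps0.
set iso := event (isolated _) _; set ne := event neq2 _ => h.
have [dbb _ _ _] := pre_distK (ms_pre N_model.1).
have := near b; rewrite dbb subr0; have := near x'; rewrite distKE -/ne.
have mu1 : 1 - mu iso <= mu (emeet (ecompl ne) (ecompl iso)) + mu ne.
  have := mu_compl iso; have := mu_split (ecompl iso) ne.
  have := mu_meet_le ne (ecompl iso); rewrite (emeetC (ecompl iso) (ecompl ne)).
  by rewrite (emeetC (ecompl iso) ne); lra.
have := mu_ge0 (emeet (ecompl ne) (ecompl iso)).
move: h mu1; rewrite !ler_norml.
case: (ger0P (value Phi (scons x' e) _ - _)); lra.
Qed.

End ModelFacts.

(** * Definable predicates *)

Section CatEnv.
Variable X : Type.

(** Free variables come first and parameters last, so that a quantifier over variable 0 leaves the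
    parameters in place. *)
Definition cat_env k n (e : 'I_k -> X) (a : 'I_n -> X) : 'I_(k + n) -> X :=
  fun i => match fintype.split i with inl j => e j | inr j => a j end.

Lemma cat_envl k n (e : 'I_k -> X) (a : 'I_n -> X) j :
  cat_env e a (lshift n j) = e j.
Proof. by rewrite /cat_env -[lshift n j]/(fintype.unsplit (inl j)) fintype.unsplitK. Qed.

Lemma cat_envr k n (e : 'I_k -> X) (a : 'I_n -> X) j :
  cat_env e a (rshift k j) = a j.
Proof. by rewrite /cat_env -[rshift k j]/(fintype.unsplit (inr j)) fintype.unsplitK. Qed.

Lemma cat_env_eqP k n (e : 'I_k -> X) (a : 'I_n -> X) (u : 'I_(k + n) -> X) :
  (forall j, u (lshift n j) = e j) -> (forall j, u (rshift k j) = a j) ->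
  u = cat_env e a.
Proof.
move=> ul ur; apply/funext => i; case: (split_ordP i) => j ->.
  by rewrite ul cat_envl.
by rewrite ur cat_envr.
Qed.

Lemma scons_cat_env k n x (e : 'I_k -> X) (a : 'I_n -> X) :
  scons x (cat_env e a) = cat_env (scons x e) a :> ('I_(k.+1 + n) -> X).
Proof.
apply: cat_env_eqP => j.
  case: (unliftP ord0 j) => [i|] ->.
    rewrite (_ : lshift n (lift ord0 i) = lift ord0 (lshift n i)); last exact: val_inj.
    by rewrite !sconsS cat_envl.
  rewrite (_ : lshift n (ord0 : 'I_k.+1) = (ord0 : 'I_(k + n).+1)); last exact: val_inj.
  by rewrite !scons0.
rewrite (_ : rshift k.+1 j = lift ord0 (rshift k j)); last exact: val_inj.
by rewrite sconsS cat_envr.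
Qed.

Lemma cat_env1 n (e : 'I_1 -> X) (a : 'I_n -> X) :
  cat_env e a = scons (e ord0) a.
Proof.
apply/esym/cat_env_eqP => j.
  rewrite (ord1 j) (_ : lshift n (ord0 : 'I_1) = (ord0 : 'I_n.+1)) ?scons0 //.
  exact: val_inj.
rewrite (_ : rshift 1 j = (lift ord0 j : 'I_n.+1)) ?sconsS //.
exact: val_inj.
Qed.

Lemma cat_env0 n (e : 'I_0 -> X) (a : 'I_n -> X) : cat_env e a = a.
Proof.
apply/esym/cat_env_eqP => [[]//|j]; congr a; exact: val_inj.
Qed.

End CatEnv.

Lemma cat_env_map (X Y : Type) (f : X -> Y) k n (e : 'I_k -> X) (a : 'I_n -> X) :
  (fun i => f (cat_env e a i)) = cat_env (fun i => f (e i)) (fun i => f (a i)).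
Proof. by apply: cat_env_eqP => j; rewrite ?cat_envl ?cat_envr. Qed.

(** * Infima under perturbation and penalty *)

Section InfimumLemmas.
Variables (R : realType) (X : Type).
Hypothesis hX : inhabited X.
Implicit Types f g : X -> R.

Lemma inf_range_le f g eps : (forall x, 0 <= f x) ->
  (forall x, f x <= g x + eps) -> inf (range f) <= inf (range g) + eps.
Proof.
case: hX => x0 f0 fg; rewrite -lerBlDr; apply: lb_le_inf.
  by exists (g x0); exists x0.
move=> _ [x _ <-]; rewrite lerBlDr; apply: le_trans (fg x).
by apply: ge_inf; [exists 0 => _ [y _ <-]|exists x].
Qed.

Lemma inf_range_dist f g eps : (forall x, 0 <= f x) -> (forall x, 0 <= g x) ->
  (forall x, `|f x - g x| <= eps) -> `|inf (range f) - inf (range g)| <= eps.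
Proof.
move=> f0 g0 fg.
have h1 : inf (range f) <= inf (range g) + eps.
  by apply: inf_range_le => // x; have := fg x; rewrite ler_norml; lra.
have h2 : inf (range g) <= inf (range f) + eps.
  by apply: inf_range_le => // x; have := fg x; rewrite ler_norml; lra.
by rewrite ler_norml; lra.
Qed.

(** Away from [x0] the penalty [g x] makes up for any drop of [f], so the infimum is attained at
    [x0]. The truncation is harmless since [f x0 <= 1]. *)
Lemma inf_penalty f g x0 : g x0 = 0 -> (forall x, 0 <= f x <= 1) ->
  (forall x, `|f x - f x0| <= g x) ->
  inf (range (fun x => Num.min 1 (f x + g x))) = f x0.
Proof.
move=> g0 f01 lip; have /andP[_ fx0] := f01 x0.
apply/le_anti/andP; split.
  apply: ge_inf; last by exists x0 => //; rewrite g0 addr0 min_r.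
  exists 0 => _ [x _ <-]; rewrite le_min ler01 /=.
  by have := f01 x; have := lip x; rewrite ler_norml; lra.
apply: lb_le_inf; first by eexists; exists x0.
move=> _ [x _ <-]; rewrite le_min fx0 /=.
by have := lip x; rewrite ler_norml; lra.
Qed.

End InfimumLemmas.

Section DefinablePredicates.
Variables (R : realType) (L : signature) (N : interpretation R L).
Hypothesis bN : bounded_interp N.
Variable A : set (sortK N).

Local Notation pred_on k b := (('I_k -> sortK N) -> ('I_b -> sortB N) -> R).

(** A uniform limit of formulas with parameters from [A], whose number may grow as [eps] shrinks.
    This common form, with free variables of both sorts, contains definability of elements and of
    events as special cases. *)
Definition definable_pred k b (f : pred_on k b) : Prop :=
  forall eps, 0 < eps -> exists (n : nat) (Phi : cformula R L (k + n) b)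
    (a : 'I_n -> sortK N), (forall i, A (a i)) /\
    forall eK eB, `|value Phi (cat_env eK a) eB - f eK eB| <= eps.

Lemma definable_pred_formula k n b (Phi : cformula R L (k + n) b)
    (a : 'I_n -> sortK N) : (forall i, A (a i)) ->
  definable_pred (fun eK eB => value Phi (cat_env eK a) eB).
Proof.
move=> Aa eps eps0; exists n, Phi, a; split=> // eK eB.
by rewrite subrr normr0 ltW.
Qed.

Lemma definable_pred_limit k b (f : pred_on k b) :
  (forall eps, 0 < eps -> exists2 g : pred_on k b, definable_pred g &
    forall eK eB, `|g eK eB - f eK eB| <= eps) -> definable_pred f.
Proof.
move=> h eps eps0; have e2 : 0 < eps / 2 by rewrite divr_gt0.
have [g dg gf] := h _ e2; have [n [Phi [a [Aa Phig]]]] := dg _ e2.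
exists n, Phi, a; split=> // eK eB.
rewrite (le_trans (ler_distD (g eK eB) _ _)) // [leRHS]splitr.
exact: lerD.
Qed.

Lemma definable_pred_ren k b k' b' (rK : 'I_k -> 'I_k') (rB : 'I_b -> 'I_b')
    (f : pred_on k b) : definable_pred f ->
  definable_pred (fun eK eB => f (comp_env rK eK) (comp_env rB eB)).
Proof.
move=> df eps eps0; have [n [Phi [a [Aa Phif]]]] := df _ eps0.
exists n, (cren Phi (cat_env (fun i => lshift n (rK i)) (@rshift k' n)) rB), a.
split=> // eK eB; rewrite value_cren /(comp_env (cat_env _ _)).
rewrite (cat_env_map (cat_env eK a)).
rewrite (_ : (fun i => _ (lshift n _)) = comp_env rK eK); last first.
  by apply/funext => i; rewrite cat_envl.
by rewrite (_ : (fun i => _ (rshift k' i)) = a) //; apply/funext => i; rewrite cat_envr.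
Qed.

Lemma definable_pred_add k b (f g : pred_on k b) :
  definable_pred f -> definable_pred g ->
  definable_pred (fun eK eB => Num.min 1 (f eK eB + g eK eB)).
Proof.
move=> df dg eps eps0; have e2 : 0 < eps / 2 by rewrite divr_gt0.
have [n1 [Phi [a [Aa Phif]]]] := df _ e2.
have [n2 [Psi [c [Ac Psig]]]] := dg _ e2.
exists (n1 + n2)%N, (cadd
  (cren Phi (cat_env (@lshift k _) (fun i => rshift k (lshift n2 i))) id)
  (cren Psi (cat_env (@lshift k _) (fun i => rshift k (rshift n1 i))) id)),
  (cat_env a c).
split=> [i|eK eB]; first by rewrite /cat_env; case: fintype.split.
rewrite value_cadd // !value_cren.
rewrite (_ : comp_env _ (cat_env eK (cat_env a c)) = cat_env eK a); last first.
  rewrite /comp_env; apply: cat_env_eqP => j.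
    by rewrite !cat_envl.
  by rewrite !cat_envr cat_envl.
rewrite (_ : comp_env _ (cat_env eK (cat_env a c)) = cat_env eK c); last first.
  rewrite /comp_env; apply: cat_env_eqP => j.
    by rewrite !cat_envl.
  by rewrite !cat_envr.
have := Phif eK eB; have := Psig eK eB.
rewrite -[comp_env id eB]/eB !ler_norml !minEle.
by case: ifP; case: ifP; rewrite ?(leNgt 1) => /negP h1 /negP h2; lra.
Qed.

(** Taking an infimum does not increase uniform distances, so approximating formulas may be
    quantified. *)
Lemma definable_pred_infK k b (f : pred_on k.+1 b) :
  (forall eK eB, 0 <= f eK eB) -> definable_pred f ->
  definable_pred (fun eK eB => inf (range (fun x => f (scons x eK) eB))).
Proof.
move=> f0 df eps eps0; have [n [Phi [a [Aa Phif]]]] := df _ eps0.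
exists n, (CInfK Phi), a; split=> // eK eB; apply: inf_range_dist => [|x|x|x] //.
- by case: bN.
- by have /andP[] := value01 Phi (scons x (cat_env eK a)) eB bN.
- by rewrite scons_cat_env.
Qed.

Lemma definable_pred_infB k b (f : pred_on k b.+1) :
  (forall eK eB, 0 <= f eK eB) -> definable_pred f ->
  definable_pred (fun eK eB => inf (range (fun X => f eK (scons X eB)))).
Proof.
move=> f0 df eps eps0; have [n [Phi [a [Aa Phif]]]] := df _ eps0.
exists n, (CInfB Phi), a; split=> // eK eB; apply: inf_range_dist => [|X|X|X] //.
- by exists; exact: etop.
- by have /andP[] := value01 Phi (cat_env eK a) (scons X eB) bN.
Qed.

Lemma eq_noenv (X : Type) (e : 'I_0 -> X) : e = @noenv X.
Proof. by apply/funext => -[]. Qed.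

(** A sequence of formulas is recovered by choosing one with error [1 / (k + 1)] for each [k]. *)
Lemma definableKP (c : sortK N) : definableK A c <->
  definable_pred (fun (eK : 'I_1 -> sortK N) (_ : 'I_0 -> sortB N) =>
    distK (eK ord0) c).
Proof.
split=> [[n [Phi [a [Aa h]]]] eps eps0|h].
  have [k _ /(_ k (leqnn _)) hk] := h _ eps0.
  exists (n k), (Phi k), (a k); split=> [|eK eB]; first exact: Aa.
  by rewrite cat_env1 (eq_noenv eB) ltW // hk.
have /choice[F FP] : forall k : nat, exists F : {n : nat &
    cformula R L (1 + n) 0 * ('I_n -> sortK N)}%type,
    (forall i, A ((projT2 F).2 i)) /\ forall x : sortK N,
    `|value (projT2 F).1 (scons x (projT2 F).2) (@noenv _) - distK x c|
      <= k.+1%:R^-1.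
  move=> k; have [|n [Phi [a [Aa ha]]]] := h k.+1%:R^-1.
    by rewrite invr_gt0 ltr0n.
  exists (existT _ n (Phi, a)); split=> //= x.
  by have := ha (fun=> x) (@noenv _); rewrite cat_env1.
exists (fun k => projT1 (F k)), (fun k => (projT2 (F k)).1),
  (fun k => (projT2 (F k)).2); split=> [k|eps eps0]; first exact: (FP k).1.
have := near_infty_natSinv_lt (PosNum eps0); apply: filterS => k /= hk x.
by apply: le_lt_trans hk; exact: (FP k).2.
Qed.

Lemma definableBP (E : sortB N) : definableB A E <->
  definable_pred (fun (_ : 'I_0 -> sortK N) (eB : 'I_1 -> sortB N) =>
    distB (eB ord0) E).
Proof.
split=> [[n [Phi [a [Aa h]]]] eps eps0|h].
  have [k _ /(_ k (leqnn _)) hk] := h _ eps0.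
  exists (n k), (Phi k), (a k); split=> [|eK eB]; first exact: Aa.
  rewrite cat_env0 (_ : eB = fun=> eB ord0) ?ltW ?hk //.
  by apply/funext => i; rewrite (ord1 i).
have /choice[F FP] : forall k : nat, exists F : {n : nat &
    cformula R L (0 + n) 1 * ('I_n -> sortK N)}%type,
    (forall i, A ((projT2 F).2 i)) /\ forall X : sortB N,
    `|value (projT2 F).1 (projT2 F).2 (fun=> X) - distB X E| <= k.+1%:R^-1.
  move=> k; have [|n [Phi [a [Aa ha]]]] := h k.+1%:R^-1.
    by rewrite invr_gt0 ltr0n.
  exists (existT _ n (Phi, a)); split=> //= X.
  by have := ha (@noenv _) (fun=> X); rewrite cat_env0.
exists (fun k => projT1 (F k)), (fun k => (projT2 (F k)).1),
  (fun k => (projT2 (F k)).2); split=> [k|eps eps0]; first exact: (FP k).1.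
have := near_infty_natSinv_lt (PosNum eps0); apply: filterS => k /= hk x.
by apply: le_lt_trans hk; exact: (FP k).2.
Qed.

End DefinablePredicates.

(** * The measure algebra of a model *)

Section Events.
Variables (R : realType) (L : signature) (T : theory L) (N : interpretation R L).
Hypothesis N_model : rnd_model T N.

Let pN : pre_structure N := ms_pre N_model.1.
Let bN : bounded_interp N := pre_structure_bounded pN.
Implicit Types E F U V Y : sortB N.

Section FourEvents.
Variables E F G H : sortB N.

(** Index 3 falls outside the list and yields the default [H]. *)
Definition env4 : 'I_4 -> sortB N := fun i => nth H [:: E; F; G] i.
Local Notation "[[ t ]]" := (eeval (@noenv (sortK N)) env4 t).

Lemma boolean_identity (t1 t2 : eterm L 0 4) :
  (forall (M : structure L) (v : 'I_0 -> M) (B : 'I_4 -> Prop),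
     holds_at v B t1 <-> holds_at v B t2) -> [[t1]] = [[t2]].
Proof. by move=> h; apply: (eeval_eq N_model) => M _ v B; exact: h. Qed.

Lemma measure_identity (t t1 t2 : eterm L 0 4) :
  (forall (M : structure L) (v : 'I_0 -> M) (B : 'I_4 -> Prop),
     (holds_at v B t <-> holds_at v B t1 \/ holds_at v B t2) /\
     ~ (holds_at v B t1 /\ holds_at v B t2)) ->
  mu [[t]] = mu [[t1]] + mu [[t2]].
Proof. by move=> h; apply: (mu_additive N_model) => M _ v B; exact: h. Qed.

End FourEvents.

Let e0 : eterm L 0 4 := EVar L 0 (@Ordinal 4 0 isT).
Let e1 : eterm L 0 4 := EVar L 0 (@Ordinal 4 1 isT).
Let e2 : eterm L 0 4 := EVar L 0 (@Ordinal 4 2 isT).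
Let e3 : eterm L 0 4 := EVar L 0 (@Ordinal 4 3 isT).
Let bot : eterm L 0 4 := EBot L 0 4.

Lemma mu_bot : mu (ebot N) = 0.
Proof.
suff : mu (ebot N) = mu (ebot N) + mu (ebot N) by lra.
by apply: (@measure_identity (ebot N) (ebot N) (ebot N) (ebot N) bot bot bot)
  => M v B /=; tauto.
Qed.

Lemma meet_botl E : emeet (ebot N) E = ebot N.
Proof.
by apply: (@boolean_identity E E E E (EMeet bot e0) bot) => M v B /=; tauto.
Qed.

Lemma join_bot : ejoin (ebot N) (ebot N) = ebot N.
Proof.
by apply: (@boolean_identity (ebot N) (ebot N) (ebot N) (ebot N) (EJoin bot bot) bot)
  => M v B /=; tauto.
Qed.

Lemma meet_joinl E F G : emeet (ejoin E F) G = ejoin (emeet E G) (emeet F G).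
Proof.
by apply: (@boolean_identity E F G G (EMeet (EJoin e0 e1) e2)
  (EJoin (EMeet e0 e2) (EMeet e1 e2))) => M v B /=; tauto.
Qed.

Lemma meet_compl_join E U V :
  emeet E (ecompl (ejoin U V)) = emeet (emeet E (ecompl U)) (ecompl V).
Proof.
by apply: (@boolean_identity E U V V (EMeet e0 (ECompl (EJoin e1 e2)))
  (EMeet (EMeet e0 (ECompl e1)) (ECompl e2))) => M v B /=; tauto.
Qed.

Lemma meet_complr E U : emeet (emeet E (ecompl U)) (ecompl E) = ebot N.
Proof.
by apply: (@boolean_identity E U U U (EMeet (EMeet e0 (ECompl e1)) (ECompl e0)) bot)
  => M v B /=; tauto.
Qed.

Lemma meet_differences E U F V :
  emeet (emeet E (ecompl U)) (emeet F (ecompl V))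
  = emeet (emeet E (ecompl V)) (emeet F (ecompl U)).
Proof.
by apply: (@boolean_identity E U F V (EMeet (EMeet e0 (ECompl e1)) (EMeet e2 (ECompl e3)))
  (EMeet (EMeet e0 (ECompl e3)) (EMeet e2 (ECompl e1)))) => M v B /=; tauto.
Qed.

Lemma mu_join_difference U E : mu (ejoin U E) = mu U + mu (emeet E (ecompl U)).
Proof.
apply: (@measure_identity U E E E (EJoin e0 e1) e0 (EMeet e1 (ECompl e0)))
  => M v B /=.
by have [|] := pselect (B (@Ordinal 4 0 isT)); tauto.
Qed.

Lemma mu_join_disjoint U E Y : emeet U E = ebot N ->
  mu (emeet (ejoin U E) Y) = mu (emeet U Y) + mu (emeet E Y).
Proof.
move=> UE.
have -> : mu (emeet (ejoin U E) Y)
    = mu (emeet U Y) + mu (emeet (emeet E (ecompl U)) Y).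
  apply: (@measure_identity U E Y Y (EMeet (EJoin e0 e1) e2) (EMeet e0 e2)
    (EMeet (EMeet e1 (ECompl e0)) e2)) => M v B /=.
  by have [|] := pselect (B (@Ordinal 4 0 isT)); tauto.
congr (_ + _).
have -> : mu (emeet E Y)
    = mu (emeet (emeet U E) Y) + mu (emeet (emeet E (ecompl U)) Y).
  apply: (@measure_identity U E Y Y (EMeet e1 e2) (EMeet (EMeet e0 e1) e2)
    (EMeet (EMeet e1 (ECompl e0)) e2)) => M v B /=.
  by have [|] := pselect (B (@Ordinal 4 0 isT)); tauto.
by rewrite UE meet_botl mu_bot add0r.
Qed.

Lemma mu_le_of_difference E F : emeet E (ecompl F) = ebot N -> mu E <= mu F.
Proof.
move=> EF; rewrite (mu_split N_model E F) EF mu_bot addr0.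
rewrite (emeetC N_model E F); exact: (mu_meet_le N_model).
Qed.

Fixpoint partial_union (E : nat -> sortB N) (n : nat) : sortB N :=
  if n is m.+1 then ejoin (partial_union E m) (E m) else ebot N.

Lemma partial_union_ub (E : nat -> sortB N) m n : (m < n)%N ->
  emeet (E m) (ecompl (partial_union E n)) = ebot N.
Proof.
elim: n => // n IH; rewrite ltnS leq_eqVlt /= meet_compl_join => /orP[/eqP ->|/IH ->].
  exact: meet_complr.
exact: meet_botl.
Qed.

Lemma partial_union_disjoint (E : nat -> sortB N) n m :
  (forall i j, i <> j -> emeet (E i) (E j) = ebot N) -> (n <= m)%N ->
  emeet (partial_union E n) (E m) = ebot N.
Proof.
move=> dE; elim: n => [_|n IH nm] /=; first exact: meet_botl.
rewrite meet_joinl IH ?(ltnW nm) // dE ?join_bot // => nm'.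
by rewrite nm' ltnn in nm.
Qed.

Lemma mu_partial_union (E : nat -> sortB N) n :
  (forall i j, i <> j -> emeet (E i) (E j) = ebot N) ->
  mu (partial_union E n) = series (fun k => mu (E k)) n.
Proof.
move=> dE; elim: n => [|n IH]; first by rewrite /= mu_bot /series/= big_geq.
rewrite [partial_union _ _]/= mu_join_difference IH /series /= big_nat_recr //=.
congr (_ + _); rewrite [RHS](mu_split N_model _ (partial_union E n)).
rewrite (emeetC N_model (E n) (partial_union E n)) partial_union_disjoint //.
by rewrite mu_bot add0r.
Qed.

Definition disjointed (E : nat -> sortB N) (n : nat) : sortB N :=
  emeet (E n) (ecompl (partial_union E n)).

(** For [m < n], exchanging the two complements leaves [E m] minus a union that already contains
    [E m]. *)
Lemma disjointed_disjoint (E : nat -> sortB N) m n : m <> n ->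
  emeet (disjointed E m) (disjointed E n) = ebot N.
Proof.
wlog mn : m n / (m < n)%N => [h|_].
  move=> mn; have [/h|nm|//] := ltngtP m n; first exact.
  by rewrite (emeetC N_model); apply: h => // e; apply: mn.
by rewrite /disjointed meet_differences partial_union_ub // meet_botl.
Qed.

Lemma mu_partial_union_disjointed (E : nat -> sortB N) n :
  mu (partial_union E n) = series (fun k => mu (disjointed E k)) n.
Proof.
elim: n => [|n IH]; first by rewrite /= mu_bot /series/= big_geq.
by rewrite [partial_union _ _]/= mu_join_difference IH /series /= big_nat_recr.
Qed.

Lemma event_bigdisj n (s : seq (formula L n)) (e : 'I_n -> sortK N) :
  event (bigdisj s) e = foldr (@ejoin _ _ N) (ebot N) [seq event phi e | phi <- s].
Proof.
elim: s => [|phi s IH] /=.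
  apply: (@eeval_eq _ _ _ _ N_model n 0 (EEvent 0 (fbot L n) id) (EBot L n 0) e
    (@noenv _)) => M _ v B /=; split=> // h; exfalso; exact: h.
rewrite -IH.
by apply: (@eeval_eq _ _ _ _ N_model n 0 (EEvent 0 (Or phi (bigdisj s)) id)
  (EJoin (EEvent 0 phi id) (EEvent 0 (bigdisj s) id)) e (@noenv _)).
Qed.

Lemma bigjoin_meet (l : seq (sortB N)) Y :
  (forall i, (i < size l)%N -> emeet (nth (ebot N) l i) Y = ebot N) ->
  emeet (foldr (@ejoin _ _ N) (ebot N) l) Y = ebot N.
Proof.
elim: l => [|E l IH] h /=; first exact: meet_botl.
rewrite meet_joinl (h 0%N) // IH ?join_bot // => i il; exact: (h i.+1).
Qed.

End Events.

(** * Definable events *)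

Section Definability.
Variables (R : realType) (L : signature) (T : theory L) (N : interpretation R L).
Hypothesis N_model : rnd_model T N.
Variables (A : set (sortK N)) (b : sortK N).

Let pN : pre_structure N := ms_pre N_model.1.
Let bN : bounded_interp N := pre_structure_bounded pN.

(** Functional formulas are not closed under disjunction, so partial unions are placed in this
    larger class. *)
Definition event_over (E : sortB N) : Prop :=
  exists (n : nat) (psi : formula L n.+1) (a : 'I_n -> sortK N),
    (forall i, A (a i)) /\ E = event psi (scons b a).

Lemma fo_definable_over E : fo_definable_on A T E b -> event_over E.
Proof. by move=> [n [phi [a [_ Aa ->]]]]; exists n, phi, a. Qed.

Lemma event_fbot n (e : 'I_n -> sortK N) : event (fbot L n) e = ebot N.
Proof. exact: (event_bigdisj N_model [::]). Qed.

(** An unsatisfiable formula is vacuously functional; the empty event later serves as padding. *)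
Lemma fo_definable_bot : fo_definable_on A T (ebot N) b.
Proof.
exists 0%N, (fbot L 1), (@noenv _); split=> [M _ v u u'|[]//|].
  by move=> h; exfalso; apply: h.
by rewrite event_fbot.
Qed.

Lemma cat_env_A n1 n2 (a : 'I_n1 -> sortK N) (c : 'I_n2 -> sortK N) :
  (forall i, A (a i)) -> (forall i, A (c i)) -> forall i, A (cat_env a c i).
Proof. by move=> Aa Ac i; rewrite /cat_env; case: fintype.split. Qed.

Lemma comp_env_catl (X : Type) n1 n2 (x : X) (a : 'I_n1 -> X) (c : 'I_n2 -> X) :
  comp_env (lift_ren (@lshift n1 n2)) (scons x (cat_env a c)) = scons x a.
Proof.
rewrite comp_env_lift; congr scons; apply/funext => i; exact: cat_envl.
Qed.

Lemma comp_env_catr (X : Type) n1 n2 (x : X) (a : 'I_n1 -> X) (c : 'I_n2 -> X) :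
  comp_env (lift_ren (@rshift n1 n2)) (scons x (cat_env a c)) = scons x c.
Proof.
rewrite comp_env_lift; congr scons; apply/funext => i; exact: cat_envr.
Qed.

Lemma event_over_join E F :
  event_over E -> event_over F -> event_over (ejoin E F).
Proof.
move=> [n1 [phi [a [Aa ->]]]] [n2 [psi [c [Ac ->]]]].
exists (n1 + n2)%N, (Or (fren phi (lift_ren (@lshift n1 n2)))
  (fren psi (lift_ren (@rshift n1 n2)))), (cat_env a c).
split; first exact: cat_env_A.
have := @eeval_eq _ _ _ _ N_model (n1 + n2).+1 0
  (EJoin (EEvent 0 phi (lift_ren (@lshift n1 n2)))
     (EEvent 0 psi (lift_ren (@rshift n1 n2))))
  (EEvent 0 (Or (fren phi (lift_ren (@lshift n1 n2)))
     (fren psi (lift_ren (@rshift n1 n2)))) id) (scons b (cat_env a c)) (@noenv _).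
rewrite /= -!/(comp_env _ _) comp_env_catl comp_env_catr; apply => M _ v B /=.
by rewrite !sat_fren.
Qed.

(** A conjunction with a functional formula is functional, whatever the other conjunct. *)
Lemma fo_definable_difference E F : fo_definable_on A T E b -> event_over F ->
  fo_definable_on A T (emeet E (ecompl F)) b.
Proof.
move=> [n1 [phi [a [fphi Aa ->]]]] [n2 [psi [c [Ac ->]]]].
exists (n1 + n2)%N, (And (fren phi (lift_ren (@lshift n1 n2)))
  (Neg (fren psi (lift_ren (@rshift n1 n2))))), (cat_env a c).
split; last 1 first.
- have := @eeval_eq _ _ _ _ N_model (n1 + n2).+1 0
    (EMeet (EEvent 0 phi (lift_ren (@lshift n1 n2)))
       (ECompl (EEvent 0 psi (lift_ren (@rshift n1 n2)))))
    (EEvent 0 (And (fren phi (lift_ren (@lshift n1 n2)))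
       (Neg (fren psi (lift_ren (@rshift n1 n2))))) id)
    (scons b (cat_env a c)) (@noenv _).
  rewrite /= -!/(comp_env _ _) comp_env_catl comp_env_catr; apply => M _ v B /=.
  by rewrite !sat_fren.
- move=> M TM v u u' /= [+ _] [+ _]; rewrite !sat_fren !comp_env_lift.
  exact: fphi.
- exact: cat_env_A.
Qed.

Lemma partial_union_over (E : nat -> sortB N) n :
  (forall k, fo_definable_on A T (E k) b) -> event_over (partial_union E n).
Proof.
move=> hE; elim: n => [|n IH] /=; first exact: fo_definable_over fo_definable_bot.
by apply: event_over_join => //; exact: fo_definable_over.
Qed.

Lemma distK_self (x : sortK N) : distK x x = 0.
Proof. by case: (pre_distK pN). Qed.

Lemma distB_self (E : sortB N) : distB E E = 0.
Proof. by case: (pre_distB pN). Qed.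

Lemma distB_lip (E F G : sortB N) : `|distB E F - distB E G| <= distB F G.
Proof.
case: (pre_distB pN) => _ sym tri _; rewrite ler_norml.
have := tri E F G; have := tri E G F; rewrite (sym G F); lra.
Qed.

Lemma event_lip n (phi : formula L n.+1) (a : 'I_n -> sortK N) (x y : sortK N) :
  distB (event phi (scons x a)) (event phi (scons y a)) <= distK x y.
Proof.
apply: le_trans (pre_event_cont pN _ _ _) _.
rewrite big_ord_recl !scons0 big1 ?addr0 // => i _.
by rewrite !sconsS distK_self.
Qed.

(** The event of [psi] is 1-Lipschitz in its first argument. Hence [b] can be replaced by a bound
    variable [y] at the cost of the penalty [distK y b], which is a definable predicate. *)
Lemma definable_event_over E :
  definableK A b -> event_over E -> definableB A E.
Proof.
move=> /definableKP db [n [phi [a [Aa ->]]]]; apply/definableBP.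
pose Phi : cformula R L (1 + n) 1 :=
  CDistB R (EVar L _ ord0) (EEvent 1 phi (id : 'I_n.+1 -> 'I_(1 + n))).
have dPhi := definable_pred_formula Phi Aa.
have ddb := definable_pred_ren (id : 'I_1 -> 'I_1)
  (fun i : 'I_0 => False_rect 'I_1 (notF (ltn_ord i))) db.
have := definable_pred_infK bN _ (definable_pred_add bN dPhi ddb).
have E1 (x y : R) : 0 <= x -> 0 <= y -> 0 <= Num.min 1 (x + y).
  by move=> x0 y0; rewrite le_min ler01 addr_ge0.
have dK0 (x y : sortK N) : 0 <= distK x y by case: bN => _ _ h _; case/andP: (h x y).
have H : forall (eK : 'I_1 -> sortK N) eB, 0 <= Num.min 1
    (value Phi (cat_env eK a) eB + distK (comp_env id eK ord0) b).
  by move=> eK eB; apply: E1 => //; case/andP: (value01 Phi (cat_env eK a) eB bN).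
move=> /(_ H); congr definable_pred; apply/funext => eK; apply/funext => eB.
rewrite -[RHS](@inf_penalty _ _
  (fun y => distB (eB ord0) (event phi (scons y a))) (fun y => distK y b) b).
- congr inf; congr (_ @` _); apply/funext => y; rewrite /= cat_env1.
  by rewrite /comp_env scons0.
- exact: distK_self.
- by move=> y; case: bN.
- by move=> y; apply: le_trans (distB_lip _ _ _) (event_lip _ _ _ _).
Qed.

(** Here [E] is replaced by a bound event [X] with penalty [distB X E]. If [phi] is functional and
    [E] is its event at [b], the predicate measures the part of [E] where the variable differs from
    [b]. *)
Lemma definable_pred_meet E n (phi : formula L n.+1) (a : 'I_n -> sortK N) :
  definableB A E -> (forall i, A (a i)) ->
  definable_pred A (fun (eK : 'I_1 -> sortK N) (_ : 'I_0 -> sortB N) =>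
    mu (emeet E (ecompl (event phi (scons (eK ord0) a))))).
Proof.
move=> /definableBP dE Aa.
pose Phi : cformula R L (1 + n) 1 :=
  CMu R (EMeet (EVar L _ ord0) (ECompl (EEvent 1 phi (id : 'I_n.+1 -> 'I_(1 + n))))).
have dPhi := definable_pred_formula Phi Aa.
have ddE := definable_pred_ren
  (fun i : 'I_0 => False_rect 'I_1 (notF (ltn_ord i))) (id : 'I_1 -> 'I_1) dE.
have := definable_pred_infB bN _ (definable_pred_add bN dPhi ddE).
have dB0 (X Y : sortB N) : 0 <= distB X Y by case: bN => _ _ _ h; case/andP: (h X Y).
have H : forall (eK : 'I_1 -> sortK N) (eB : 'I_1 -> sortB N), 0 <= Num.min 1
    (value Phi (cat_env eK a) eB + distB (comp_env id eB ord0) E).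
  move=> eK eB; rewrite le_min ler01 addr_ge0 //.
  by case/andP: (value01 Phi (cat_env eK a) eB bN).
move=> /(_ H); congr definable_pred; apply/funext => eK; apply/funext => eB.
rewrite -[RHS](@inf_penalty _ _
  (fun X => mu (emeet X (ecompl (event phi (scons (eK ord0) a)))))
  (fun X => distB X E) E).
- congr inf; congr (_ @` _); apply/funext => X; rewrite /= cat_env1.
  by rewrite /comp_env scons0.
- exact: distB_self.
- by move=> X; case: bN.
- move=> X; apply: le_trans (pre_mu_cont pN _ _) _.
  by apply: le_trans (pre_meet_cont pN _ _ _ _) _; rewrite distB_self addr0.
Qed.

End Definability.

(** * Covering by functional events *)

Section Cover.
Variables (R : realType) (L : signature) (T : theory L) (N : interpretation R L).
Hypothesis N_model : rnd_model T N.
Variables (A : set (sortK N)) (b : sortK N).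

Let pN : pre_structure N := ms_pre N_model.1.
Let bN : bounded_interp N := pre_structure_bounded pN.

(** For a formula [Phi] close to the distance to [b], determined by [Theta], the events of the
    isolating formulas, one for each pattern, have join the event of [isolated Theta]. *)
Lemma definable_cover (eps : R) : definableK A b -> 0 < eps ->
  exists l : seq (sortB N),
    (forall i, (i < size l)%N -> fo_definable_on A T (nth (ebot N) l i) b) /\
    1 - mu (foldr (@ejoin _ _ N) (ebot N) l) <= eps.
Proof.
(* The divisor compensates the factor 4 in [isolated_large]. *)
move=> /definableKP db eps0; have e4 : 0 < eps / 4 by rewrite divr_gt0.
have [n [Phi [a [Aa near]]]] := db _ e4.
have [I [ Theta det]] := value_determined (Phi : cformula R L n.+1 0).
exists [seq event phi (scons b a)
       | phi <- [seq isolating Theta pat | pat <- enum {ffun I -> bool}]].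
split=> [i|].
  rewrite -map_comp size_map => ilt.
  rewrite (nth_map [ffun => false]) //=; exists n,
    (isolating Theta (nth [ffun => false] (enum {ffun I -> bool}) i)), a.
  by split=> //; exact: isolating_functional.
rewrite -(event_bigdisj N_model) -/(isolated Theta).
have := isolated_large N_model det e4 (b := b) (e := a); rewrite [4 * _]mulrC divfK //.
apply=> x; have := near (fun=> x) (@noenv _).
by rewrite cat_env1.
Qed.

Lemma exhaustion_of_cover :
  (forall eps : R, 0 < eps -> exists l : seq (sortB N),
    (forall i, (i < size l)%N -> fo_definable_on A T (nth (ebot N) l i) b) /\
    1 - mu (foldr (@ejoin _ _ N) (ebot N) l) <= eps) ->
  exists F : nat -> sortB N, (forall n, fo_definable_on A T (F n) b) /\
    forall eps : R, 0 < eps -> exists n, 1 - mu (partial_union F n) <= eps.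
Proof.
move=> cover.
have /choice[l lP] : forall k : nat, exists l : seq (sortB N),
    (forall i, (i < size l)%N -> fo_definable_on A T (nth (ebot N) l i) b) /\
    1 - mu (foldr (@ejoin _ _ N) (ebot N) l) <= k.+1%:R^-1.
  by move=> k; apply: cover; rewrite invr_gt0 ltr0n.
pose F m := if (unpickle m : option (nat * nat)) is Some (k, i)
  then nth (ebot N) (l k) i else ebot N.
exists F; split=> [m|eps eps0].
  rewrite /F; case: unpickle => [[k i]|]; last exact: (fo_definable_bot N_model).
  have [il|il] := ltnP i (size (l k)); first exact: (lP k).1.
  by rewrite nth_default //; exact: (fo_definable_bot N_model).
have [k _ /(_ k (leqnn _)) /= hk] := near_infty_natSinv_lt (PosNum eps0).
(* [n] exceeds the codes of all members of the k-th cover, so the first [n] events include that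
   cover. *)
pose n := (\max_(i < size (l k)) pickle (k, val i)).+1; exists n.
apply: le_trans (ltW hk); apply: le_trans (lP k).2; rewrite lerD2l lerN2.
apply: (mu_le_of_difference N_model); apply: (bigjoin_meet N_model) => i il.
have -> : nth (ebot N) (l k) i = F (pickle (k, i)) by rewrite /F pickleK.
apply: (partial_union_ub N_model); rewrite ltnS.
exact: (leq_bigmax (F := fun i : 'I_(size (l k)) => pickle (k, val i)) (Ordinal il)).
Qed.

(** Where [phi] holds of [b], it holds of [x] exactly if [x = b]: one direction is functionality,
    the other substitution. *)
Lemma meet_neq_functional n (phi : formula L n.+1) (a : 'I_n -> sortK N)
    (x : sortK N) : functional T phi ->
  emeet (event phi (scons b a)) (event (neq2 L) (scons x (fun=> b)))
  = emeet (event phi (scons b a)) (ecompl (event phi (scons x a))).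
Proof.
move=> fphi.
(* In the context [(x, b, a)], [eq01] selects [(x, b)], [lift ord0] selects [(b, a)] and [skip1]
   selects [(x, a)]. *)
pose eq01 (i : 'I_2) : 'I_n.+2 := scons ord0 (fun=> lift ord0 ord0) i.
have eq01E (X : Type) (y z : X) (e : 'I_n -> X) :
    comp_env eq01 (scons y (scons z e)) = scons y (fun=> z).
  apply/funext => i; rewrite /comp_env /eq01.
  by case: (unliftP ord0 i) => [j|] ->; rewrite ?sconsS ?scons0.
pose t1 : eterm L n.+2 0 :=
  EMeet (EEvent 0 phi (lift ord0)) (EEvent 0 (neq2 L) eq01).
pose t2 : eterm L n.+2 0 :=
  EMeet (EEvent 0 phi (lift ord0)) (ECompl (EEvent 0 phi (@skip1 n))).
have t12 : valid T (fun M v B => holds_at v B t1 <-> holds_at v B t2).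
  move=> M TM v B.
  have [u [u' [w ->]]] : exists u u' w, v = scons u (scons u' w).
    exists (v ord0), (v (lift ord0 ord0)), (fun i => v (lift ord0 (lift ord0 i))).
    by rewrite [LHS]scons_eta; congr scons; exact: scons_eta.
  rewrite /= -!/(comp_env _ _) comp_env_lift0 comp_env_skip1.
  rewrite /eq01 !sconsS !scons0.
  split=> -[pu' h]; split=> // h'; apply: h; last by rewrite h'.
  exact: (fphi M TM w).
pose e := scons x (scons b a).
have e1 : (fun i => e (lift ord0 i)) = scons b a by exact: comp_env_lift0.
have e2 : (fun i => e (skip1 i)) = scons x a by exact: comp_env_skip1.
have e3 : (fun i => e (eq01 i)) = scons x (fun=> b) by exact: eq01E.
have := eeval_eq N_model e (@noenv _) t12.
by rewrite /t1 /t2 /= e1 e2 e3.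
Qed.

End Cover.

(** * The equivalence, from covers in one direction and uniform limits in the other *)

Theorem theorem3p13 (R : realType) (L : signature) (T : theory L)
    (T_complete : complete_theory T)
    (T_two : forall M : structure L, models M T -> exists x y : M, x <> y)
    (N : interpretation R L) (N_model : rnd_model T N)
    (A : set (sortK N)) (b : sortK N) :
  definableK A b <->
  exists E : nat -> sortB N,
    [/\ forall m n : nat, m <> n -> emeet (E m) (E n) = ebot N,
        series (fun n => mu (E n)) @ \oo --> (1 : R),
        forall n : nat, definableB A (E n)
      & forall n : nat, fo_definable_on A T (E n) b].
Proof.
have pN := ms_pre N_model.1; have bN := pre_structure_bounded pN.
have mu_le1 (E : sortB N) : mu E <= 1 by case: bN => _ h _ _; case/andP: (h E).
split=> [db|[E [dE sumE defE foE]]].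
  have [F [foF coverF]] := exhaustion_of_cover N_model
    (fun eps => definable_cover N_model db (eps := eps)).
  (* Removing the earlier events makes the sequence disjoint and preserves functionality. *)
  have foD n : fo_definable_on A T (disjointed F n) b.
    apply: (fo_definable_difference N_model) => //.
    exact: (partial_union_over N_model).
  exists (disjointed F); split=> //.
  - by move=> m n; exact: (disjointed_disjoint N_model).
  (* The partial sums are the measures of the partial unions. They increase, so one good index from
     [coverF] controls all later ones. *)
  - have sumE n : series (fun k => mu (disjointed F k)) n = mu (partial_union F n).
      by rewrite (mu_partial_union_disjointed N_model).
    apply/cvgrPdist_le => eps eps0; have [n hn] := coverF _ eps0.
    exists n => // m /= nm; rewrite sumE ger0_norm ?subr_ge0 //.
    apply: le_trans hn; rewrite lerD2l lerN2 -!sumE.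
    rewrite /series /= [leRHS](big_cat_nat (n := n)) //=.
    by rewrite lerDl sumr_ge0 // => k _; exact: (mu_ge0 N_model).
  - move=> n; apply: (definable_event_over N_model) db _.
    exact: fo_definable_over (foD n).
apply/definableKP.
(* [Y] is the event that the variable differs from [b]; its measure is the distance to [b]. *)
pose Y (eK : 'I_1 -> sortK N) := event (neq2 L) (scons (eK ord0) (fun=> b)).
(* Each new disjoint event adds the measure of its part inside [Y], which can be written without [b]
   by functionality. The truncation changes nothing because the sum is again the measure of an
   event. *)
have dU n : definable_pred A (fun (eK : 'I_1 -> sortK N) (_ : 'I_0 -> sortB N) =>
    mu (emeet (partial_union E n) (Y eK))).
  elim: n => [|n IH] /=.
    move=> eps eps0; exists 0%N, (CMu R (EBot L _ 0)), (@noenv _).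
    split=> [[]//|eK eB] /=.
    by rewrite (meet_botl N_model) (mu_bot N_model) subrr normr0 ltW.
  have [m [phi [a [fphi Aa En]]]] := foE n.
  have := definable_pred_add bN IH (definable_pred_meet N_model phi (defE n) Aa).
  congr definable_pred; apply/funext => eK; apply/funext => eB.
  rewrite [X in _ + mu X](_ : _ = emeet (E n) (Y eK)); last first.
    by rewrite En /Y (meet_neq_functional N_model).
  by rewrite -(mu_join_disjoint N_model) ?min_r ?(partial_union_disjoint N_model).
apply: definable_pred_limit => eps eps0.
(* The part of [Y] outside the first [n] events has measure at most the tail of the series,
   uniformly in the variable. *)
have [n _ /(_ n (leqnn _)) hn] : \forall n \near \oo,
    `|1 - series (fun n => mu (E n)) n| <= eps.
  by move/cvgrPdist_le: sumE; exact.
exists (fun eK _ => mu (emeet (partial_union E n) (Y eK))) => // eK eB.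
rewrite (distKE N_model) -/(Y eK).
have := mu_split N_model (Y eK) (partial_union E n).
rewrite (emeetC N_model (Y eK) (partial_union E n)) => ->.
rewrite distrC addrC addKr ger0_norm; last exact: (mu_ge0 N_model).
apply: le_trans hn; rewrite -(mu_partial_union N_model) //.
rewrite -(mu_compl N_model) (emeetC N_model (Y eK)).
by apply: le_trans (ler_norm _); exact: (mu_meet_le N_model).
Qed.
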